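(* Let $s>0$, $\beta\in(0,1)$, $k,N\in\mathbb N$ with $k<N$, let $V\subset\mathbb R^k$ be open, $U:=V\times\mathbb R^{N-k}$, and let $u:\mathbb R^N\to\mathbb R$, $v:\mathbb R^k\to\mathbb R$ be functions satisfying $$u(x_1,\dots,x_N)=v(x_1,\dots,x_k)\qquad\text{for all }(x_1,\dots,x_N)\in\mathbb R^N.$$ Then $v\in\mathcal L^1_s(\mathbb R^k)\cap C^{2s+\beta}(V)$ if and only if $u\in\mathcal L^1_s(\mathbb R^N)\cap C^{2s+\beta}(U)$; furthermore, in this case, $$(-\Delta)^su(x_1,\dots,x_N)=(-\Delta)^sv(x_1,\dots,x_k)\qquad\text{for all }x\in U.$$ In particular, $u$ is $s$-harmonic in $U$ (i.e. $(-\Delta)^su=0$ in $U$) if and only if $v$ is $s$-harmonic in $V$.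
   Context: For $d\in\mathbb N$, $\mathcal L^1_s(\mathbb R^d):=\{u\in L^1_{loc}(\mathbb R^d):\int_{\mathbb R^d}\frac{|u(x)|}{1+|x|^{d+2s}}dx<\infty\}$. For $W\subset\mathbb R^d$ open and $t=n+\tau$ with $n\in\mathbb N_0$, $\tau\in(0,1]$, $C^t(W)=C^{n,\tau}(W)$ is the space of $n$-times continuously differentiable functions on $W$ whose derivatives of order $n$ are locally $\tau$-Hölder continuous (locally Lipschitz if $\tau=1$). On $\mathbb R^d$, write $s=m+\sigma$ with $m\in\mathbb N_0$, $\sigma\in(0,1]$. If $\sigma=1$, $(-\Delta)^s=(-\Delta)^{m+1}$ is the iterated Laplacian in $\mathbb R^d$. If $\sigma\in(0,1)$, $$(-\Delta)^su(x):=\frac{c_{d,s}}2\int_{\mathbb R^d}\frac{\sum_{j=-m-1}^{m+1}(-1)^j\binom{2m+2}{m+1-j}u(x+jy)}{|y|^{d+2s}}\,dy,\qquad c_{d,s}:=\frac{4^s\Gamma(\frac d2+s)}{\pi^{d/2}\Gamma(-s)}\Big(\sum_{j=1}^{m+1}(-1)^j\binom{2m+2}{m+1-j}j^{2s}\Big)^{-1},$$ which is well defined at points of $W$ for $u\in\mathcal L^1_s(\mathbb R^d)\cap C^{2s+\beta}(W)$. *)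

(* Defs.v *)
(* R^d is the type 'rV[R]_d of row vectors over R : realType. *)
From HB Require Import structures.
From mathcomp Require Import all_boot all_order all_algebra.
From mathcomp Require Import all_classical all_reals all_analysis.
From mathcomp Require Import lra.

Set Implicit Arguments.
Unset Strict Implicit.
Unset Printing Implicit Defensive.

Import Order.TTheory GRing.Theory Num.Theory.
Import numFieldNormedType.Exports.

Local Open Scope classical_set_scope.
Local Open Scope ring_scope.

(* The library's norm on 'rV[R]_d is the sup norm (same topology). *)
Definition enorm (R : realType) d (x : 'rV[R]_d) : R :=
  Num.sqrt (\sum_i x 0 i ^+ 2).

(* The sigma-algebra generated by the coordinates, i.e. the Borel one. *)
Section rV_measurable.
Context {R : realType} {d : nat}.

Let coord (i : 'I_d) (x : 'rV[R]_d) : R := x 0 i.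

Let rV_set0 : g_sigma_preimage coord set0.
Proof. exact: sigma_algebra0. Qed.

Let rV_setC A : g_sigma_preimage coord A -> g_sigma_preimage coord (~` A).
Proof. exact: sigma_algebraC. Qed.

Let rV_bigcup (F : _^nat) : (forall i, g_sigma_preimage coord (F i)) ->
  g_sigma_preimage coord (\bigcup_i (F i)).
Proof. exact: sigma_algebra_bigcup. Qed.

HB.instance Definition _ := @isMeasurable.Build default_measure_display
  'rV[R]_d (g_sigma_preimage coord) rV_set0 rV_setC rV_bigcup.

Lemma measurable_coord (i : 'I_d) :
  measurable_fun [set: 'rV[R]_d] (fun x : 'rV[R]_d => x 0 i).
Proof.
move=> _ Y mY; rewrite setTI; apply: sub_sigma_algebra => /=.
rewrite -bigcup_seq/=; exists i => /=; first by rewrite mem_index_enum.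
by exists Y => //; rewrite setTI.
Qed.

End rV_measurable.

(* (x, t) |-> (x_1, ..., x_d, t) *)
Definition row_rcons (R : realType) d (xt : 'rV[R]_d * R) : 'rV[R]_d.+1 :=
  \row_i (if unlift ord_max i is Some j then xt.1 0 j else xt.2).

Lemma measurable_row_rcons (R : realType) d :
  measurable_fun [set: 'rV[R]_d * R] (@row_rcons R d).
Proof.
pose coord (i : 'I_d.+1) (x : 'rV[R]_d.+1) : R := x 0 i.
apply: (measurability
  (\big[setU/set0]_(i < d.+1) preimage_set_system setT (coord i) measurable)).
  by [].
move=> _ [B + <-]; rewrite -bigcup_seq => -[i _] [Y mY <-].
rewrite !setTI.
suff : measurable_fun setT (coord i \o @row_rcons R d).
  by move=> /(_ measurableT Y mY); rewrite setTI.
rewrite /comp /coord.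
under eq_fun do rewrite mxE.
case: unliftP => [j _|_] /=; last exact: measurable_snd.
by apply: measurableT_comp (measurable_coord j) _.
Qed.

Section borel_lebesgue_step.
Context {R : realType} {d : nat} (mu : {measure set 'rV[R]_d -> \bar R}).

Definition borel_lebesgue_step : set 'rV[R]_d.+1 -> \bar R :=
  pushforward (mu \x @lebesgue_measure R)%E (@row_rcons R d).

Let step_measure : {measure set 'rV[R]_d.+1 -> \bar R} :=
  measure_function_pushforward__canonical__measure_function_Measure
    (mu \x @lebesgue_measure R)%E (@measurable_row_rcons R d).

Let step0 : borel_lebesgue_step set0 = 0%E.
Proof. exact: (measure0 step_measure). Qed.

Let step_ge0 A : (0 <= borel_lebesgue_step A)%E.
Proof. exact: (measure_ge0 step_measure). Qed.

Let step_sigma_additive : semi_sigma_additive borel_lebesgue_step.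
Proof. exact: (@measure_semi_sigma_additive _ _ _ step_measure). Qed.

HB.instance Definition _ := isMeasure.Build _ _ _ borel_lebesgue_step
  step0 step_ge0 step_sigma_additive.

End borel_lebesgue_step.

(* The d-fold product of the one-dimensional Lebesgue measure, on Borel sets. *)
Fixpoint borel_lebesgue (R : realType) (d : nat) :
    {measure set 'rV[R]_d -> \bar R} :=
  match d with
  | 0 => dirac (0 : 'rV[R]_0)
  | d'.+1 => borel_lebesgue_step (borel_lebesgue R d')
  end.

(* R^d with the sigma-algebra of Lebesgue measurable sets, obtained by
   completion as in the library's completed_lebesgue_measure. *)
Definition lebesgueRd (R : realType) (d : nat) :=
  caratheodory_type ((borel_lebesgue R d)^*)%mu.

HB.instance Definition _ (R : realType) d := Measurable.on (lebesgueRd R d).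

Definition lebesgue (R : realType) (d : nat) :
    {measure set (lebesgueRd R d) -> \bar R} :=
  @completed_measure_extension _ _ R (borel_lebesgue R d).

Definition L1loc (R : realType) d (u : 'rV[R]_d -> R) : Prop :=
  measurable_fun [set: lebesgueRd R d] u /\
  forall K : set 'rV[R]_d, compact K ->
    (\int[lebesgue R d]_(x in K) `|u x|%:E < +oo)%E.

Definition L1s (R : realType) d (s : R) (u : 'rV[R]_d -> R) : Prop :=
  L1loc u /\
  (\int[lebesgue R d]_x (`|u x| / (1 + enorm x `^ (d%:R + 2 * s)))%:E < +oo)%E.

(* The decomposition t = n + tau with n : nat and 0 < tau <= 1, for t > 0. *)
Definition ipart (R : realType) (t : R) : nat := `|Num.ceil t|%N.-1.
Definition fpart (R : realType) (t : R) : R := t - (ipart t)%:R.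

Lemma fpart_bounds (R : realType) (t : R) : 0 < t -> 0 < fpart t <= 1.
Proof.
move=> t0; have /andP[] := ceil_itv t.
have : 0 < Num.ceil t by rewrite ceil_gt0.
rewrite /fpart /ipart; case: (Num.ceil t) => [[|n]|n] //= _.
rewrite intrD rmorphN1 -pmulrn -[n.+1]addn1 natrD => h1 h2.
by apply/andP; split; lra.
Qed.

Definition basis_vec (R : realType) d (i : 'I_d) : 'rV[R]_d := delta_mx 0 i.

(* The iterated partial derivative d_(i1) (d_(i2) (... (d_(ip) f))) for
   l = [:: i1; ...; ip]. *)
Definition dpartial (R : realType) d (l : seq 'I_d) (f : 'rV[R]_d -> R) :
    'rV[R]_d -> R :=
  foldr (fun i g => 'D_(basis_vec R i) g) f l.

Definition Cn (R : realType) d (n : nat) (W : set 'rV[R]_d)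
    (f : 'rV[R]_d -> R) : Prop :=
  (forall (l : seq 'I_d) (i : 'I_d) x, (size l < n)%N -> W x ->
     derivable (dpartial l f) x (basis_vec R i)) /\
  (forall (l : seq 'I_d) x, (size l <= n)%N -> W x ->
     {for x, continuous (dpartial l f)}).

Definition locally_hoelder (R : realType) d (tau : R) (W : set 'rV[R]_d)
    (g : 'rV[R]_d -> R) : Prop :=
  forall x, W x -> exists2 A : set 'rV[R]_d, nbhs x A &
    exists C : R, forall y z, (W `&` A) y -> (W `&` A) z ->
      `|g y - g z| <= C * enorm (y - z) `^ tau.

Definition Ct (R : realType) d (t : R) (W : set 'rV[R]_d)
    (f : 'rV[R]_d -> R) : Prop :=
  Cn (ipart t) W f /\
  forall l : seq 'I_d, size l = ipart t ->
    locally_hoelder (fpart t) W (dpartial l f).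

Definition Gamma_pos (R : realType) (x : R) : R :=
  \int[@lebesgue_measure R]_(t in `]0, +oo[) (t `^ (x - 1) * expR (- t)).

(* Euler's integral for x > 0, extended to negative non-integers by
   Gamma x = Gamma (x + n) / (x (x + 1) ... (x + n - 1)), where n = 0 if x >= 0
   and n = - floor x otherwise. The value at the poles is irrelevant. *)
Definition Gamma (R : realType) (x : R) : R :=
  let n := absz (Num.min 0 (Num.floor x)) in
  Gamma_pos (x + n%:R) / \prod_(i < n) (x + i%:R).

Definition cds (R : realType) (d : nat) (s : R) : R :=
  let m := ipart s in
  4 `^ s * Gamma (d%:R / 2 + s) / (pi `^ (d%:R / 2) * Gamma (- s)) *
  (\sum_(1 <= j < m.+2)
     (-1) ^+ j * 'C(2 * m + 2, m + 1 - j)%:R * j%:R `^ (2 * s))^-1.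

(* The sum over -m-1 <= j <= m+1, indexed by i = m + 1 - j. *)
Definition cdiff (R : realType) d (m : nat) (u : 'rV[R]_d -> R)
    (x y : 'rV[R]_d) : R :=
  \sum_(0 <= i < 2 * m + 3)
    let j : int := (m + 1)%:Z - i%:Z in
    (-1) ^ j * 'C(2 * m + 2, i)%:R * u (x + j%:~R *: y).

Definition laplacian (R : realType) d (f : 'rV[R]_d -> R) : 'rV[R]_d -> R :=
  fun x => \sum_(i < d) dpartial [:: i; i] f x.

Definition frac_laplacian (R : realType) d (s : R) (u : 'rV[R]_d -> R)
    (x : 'rV[R]_d) : R :=
  let m := ipart s in
  if fpart s == 1 then iter m.+1 (fun f y => - laplacian f y) u x
  else cds d s / 2 *
    \int[lebesgue R d]_y (cdiff m u x y / enorm y `^ (d%:R + 2 * s)).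

Definition s_harmonic (R : realType) d (s : R) (W : set 'rV[R]_d)
    (u : 'rV[R]_d -> R) : Prop :=
  forall x, W x -> frac_laplacian s u x = 0.

(* (x_1, ..., x_N) |-> (x_1, ..., x_k) *)
Definition first_coords (R : realType) (k N : nat) (kN : (k < N)%N)
    (x : 'rV[R]_N) : 'rV[R]_k :=
  \row_(i < k) x 0 (widen_ord (ltnW kN) i).

(* Main.v *)
Require Import Defs.
From HB Require Import structures.
From mathcomp Require Import all_boot all_order all_algebra.
From mathcomp Require Import all_classical all_reals all_analysis.
From mathcomp Require Import measurable_realfun ring lra.

Set Implicit Arguments.
Unset Strict Implicit.
Unset Printing Implicit Defensive.

Import Order.TTheory GRing.Theory Num.Theory.
Import numFieldNormedType.Exports.

Local Open Scope classical_set_scope.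
Local Open Scope ring_scope.

(** The idea is to remove one variable at a time, integrating it out.  Write
    z = (x, t) with x in R^d and t real, and let u (x, t) = v x.

    - The finite difference that defines the fractional Laplacian of u at z
      depends on the increment only through its first d coordinates, and equals
      the finite difference of v.  By Tonelli, integrating it against the kernel
      |(y, t)|^-(d+1+2s) amounts to integrating the finite difference of v
      against the t-integral of this kernel, and a dilation of the line gives
      int (q + t^2)^-(a + 1/2) dt = q^-a K(a + 1/2),
      K(a) = int (1 + t^2)^-a dt,
      with q = |y|^2 and a = d/2 + s ([integral_weight],
      [lebesgue_integral_cylinder]).  The kernel of R^d appears, times the
      constant K(a + 1/2).
    - This constant is exactly what distinguishes the normalizing factors in
      dimensions d + 1 and d: the integral Gamma(a) K(a) becomes
      sqrt(pi) Gamma(a - 1/2) when (1 + t^2)^-a is represented as a Gamma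
      integral and the resulting Gaussian in t is integrated first
      ([gamma_japanese_integral], [cds_japanese]).
    - The same computation with q = 1 + |x|^2 shows that the weighted L^1 norms
      of u and v are comparable, because 1 + |x|^(d+2s) is comparable with
      (1 + |x|^2)^(d/2+s) ([L1s_init]).  Local integrability
      follows, the weight being bounded below on compact sets.
    - Partial derivatives of u in an old direction are partial derivatives of v,
      and vanish in the new one, whatever the regularity of v, since the
      difference quotients themselves agree; this settles the classes C^t and
      the iterated Laplacians ([Ct_init], [laplacian_init]).

    Lebesgue measurable functions are handled by replacing them by Borel
    functions that agree with them off a Borel null set
    ([completed_measurable_ae]).  What remains to be known about null sets is
    that cylinders over them are null, that almost all of their slices are null,
    and that their affine images are null; all of it follows from Tonelli. *)

(** * Completed measures: Borel representatives *)

Section completion.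
Context d (T : measurableType d) (R : realType) (mu : {measure set T -> \bar R}).
Local Notation cT := (caratheodory_type (mu^*)%mu).
Local Notation cmu :=
  (@completed_measure_extension _ _ R mu : {measure set cT -> \bar R}).

(** Measurable covers of E with measure within 1/n of the outer measure of E are
    intersected; if the outer measure is infinite, the whole space will do. *)
Lemma measurable_hull (E : set T) :
  exists B, [/\ measurable B, E `<=` B & mu B = (mu^*)%mu E].
Proof.
have [Eoo|Eoo] := eqVneq ((mu^*)%mu E) +oo%E.
  exists setT; split => //; rewrite Eoo; apply/eqP; rewrite -leye_eq -Eoo.
  by rewrite -(measurable_mu_extE mu measurableT) le_mu_ext.
have Efin : (mu^*)%mu E \is a fin_num by rewrite ge0_fin_numE ?mu_ext_ge0 ?ltey.
have cover (n : nat) : exists B,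
    [/\ measurable B, E `<=` B & (mu B <= (mu^*)%mu E + n.+1%:R^-1%:E)%E].
  have n0 : (0 < n.+1%:R^-1 :> R)%R by rewrite invr_gt0.
  have [_ [A [mA EA] <-] lt] := lb_ereal_inf_adherent n0 Efin.
  exists (\bigcup_k A k); split => //; first exact: bigcupT_measurable.
  apply: le_trans (ltW lt).
  rewrite -(measurable_mu_extE mu); last exact: bigcupT_measurable.
  apply: (le_trans (mu_ext_sigma_subadditive (measure_ge0 mu) A)).
  by apply: lee_nneseries => // k _; rewrite measurable_mu_extE.
have [B BP] := choice cover.
exists (\bigcap_n B n); split.
- by apply: bigcapT_measurable => n; have [] := BP n.
- by apply: sub_bigcap => n _; have [] := BP n.
apply/eqP; rewrite eq_le; apply/andP; split; last first.
  rewrite -(measurable_mu_extE mu).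
    by apply: le_mu_ext; apply: sub_bigcap => n _; have [] := BP n.
  by apply: bigcapT_measurable => n; have [] := BP n.
apply/lee_addgt0Pr => _/posnumP[e]; near \oo => n.
have [mB _ le] := BP n.
apply: (@le_trans _ _ (mu (B n))).
  apply: le_measure; rewrite ?inE//; last exact: bigcap_inf.
  by apply: bigcapT_measurable => k; have [] := BP k.
apply: le_trans le _; rewrite leeD2l// lee_fin ltW//.
by near: n; exact: near_infty_natSinv_lt.
Unshelve. all: by end_near. Qed.

Lemma completed_negligible_measurable (E N : set T) :
  measurable N -> mu N = 0%E -> E `<=` N -> measurable (E : set cT).
Proof.
move=> mN N0 EN; apply: measure_is_complete_caratheodory; exists N; split => //.
  by apply: sub_caratheodory; exact: sub_sigma_algebra.
by transitivity (mu N) => //; exact: measurable_mu_extE.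
Qed.

Lemma completed_measurable (E : set T) : measurable E -> measurable (E : set cT).
Proof. by move=> mE; apply: sub_caratheodory; exact: sub_sigma_algebra. Qed.

(** On a piece of finite measure, E is contained in a measurable hull H of the
    same measure, so that H minus E is null, and is itself contained in a null
    measurable hull; sigma-finiteness glues countably many pieces. *)
Lemma completed_measurable_set_ae (sf : sigma_finite setT mu) (E : set T) :
  measurable (E : set cT) ->
  exists B N, [/\ measurable B, measurable N, mu N = 0%E &
    forall x, ~ N x -> E x <-> B x].
Proof.
move=> mE; have [F TF mF] := sf.
have piece n : exists BN : set T * set T, [/\ measurable BN.1, measurable BN.2,
    mu BN.2 = 0%E & forall x, ~ BN.2 x -> (E `&` F n) x <-> BN.1 x].
  have [mFn Fnoo] := mF n.
  have mEF : measurable (E `&` F n : set cT).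
    by apply: measurableI => //; exact: completed_measurable.
  have [B [mB EB muB]] := measurable_hull (E `&` F n).
  have [N [mN EN muN]] := measurable_hull (B `\` (E `&` F n)).
  have mEFoo : ((mu^*)%mu (E `&` F n) < +oo)%E.
    apply: le_lt_trans Fnoo.
    by rewrite -(measurable_mu_extE mu mFn); apply: le_mu_ext; exact: subIsetr.
  exists (B, N); split => //=.
    have cmuB : cmu B = mu B by exact: measurable_mu_extE.
    rewrite muN -[LHS]/(cmu (B `\` (E `&` F n))) measureD//.
    - rewrite setIidr// [X in (X - _)%E]cmuB muB subee//.
      by rewrite ge0_fin_numE ?mu_ext_ge0.
    - exact: completed_measurable.
    - by rewrite [X in (X < _)%E]cmuB muB.
  move=> x Nx; split => [/EB//|Bx].
  by apply: contrapT => ?; apply: Nx; apply: EN.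
have [BN BNP] := choice piece.
exists (\bigcup_n (BN n).1), (\bigcup_n (BN n).2); split.
- by apply: bigcupT_measurable => n; have [] := BNP n.
- by apply: bigcupT_measurable => n; have [] := BNP n.
- apply/negligibleP.
    by apply: bigcupT_measurable => n; have [] := BNP n.
  apply: negligible_bigcup => n; have [_ mN N0 _] := BNP n.
  exact/negligibleP.
move=> x Nx; split => [Ex|[n _ Bx]].
  have : [set: T] x by [].
  rewrite TF => -[n _ Fnx]; exists n => //.
  have [_ _ _ h] := BNP n; apply/h; last by split.
  by move=> ?; apply: Nx; exists n.
have [_ _ _ h] := BNP n.
have NBx : ~ (BN n).2 x by move=> ?; apply: Nx; exists n.
by have [] := (h x NBx).2 Bx.
Qed.

(** The exceptional set is required to be measurable, and not merely negligible, so
    that it can be pulled back along measurable maps. *)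
Definition ae_measurable (f : T -> R) := exists g N,
  [/\ measurable_fun setT g, measurable N, mu N = 0%E &
    forall x, ~ N x -> f x = g x].

Lemma ae_measurable_completed f :
  ae_measurable f -> measurable_fun [set: cT] f.
Proof.
move=> [g [N [mg mN N0 fg]]] _ Y mY; rewrite setTI.
have -> : f @^-1` Y = ((g @^-1` Y) `&` ~` N) `|` ((f @^-1` Y) `&` N).
  apply/seteqP; split => x /=.
    by move=> Yx; have [Nx|Nx] := pselect (N x); [right|left; rewrite -fg].
  by move=> [[]|[]//] => + Nx; rewrite -fg.
apply: measurableU; last first.
  exact: completed_negligible_measurable (@subIsetr _ _ _).
apply: completed_measurable; apply: measurableI; last exact: measurableC.
by rewrite -[_ @^-1` _]setTI; exact: mg.
Qed.

(** Each of the sets {f > q}, q rational, agrees with a measurable set off a null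
    measurable set.  Setting f to 0 on the union of these null sets makes it
    measurable, since {f > r} is the union of the {f > q} with q > r. *)
Lemma completed_measurable_ae (sf : sigma_finite setT mu) f :
  measurable_fun [set: cT] f -> ae_measurable f.
Proof.
move=> mf.
pose rat_seq n : rat := odflt 0 (unpickle n).
have rep n : exists BN : set T * set T,
    [/\ measurable BN.1, measurable BN.2, mu BN.2 = 0%E &
    forall x, ~ BN.2 x -> (f @^-1` `]ratr (rat_seq n), +oo[) x <-> BN.1 x].
  have mE : measurable (f @^-1` `]ratr (rat_seq n), +oo[ : set cT).
    by rewrite -[_ @^-1` _]setTI; exact: mf.
  by have [B [N []]] := completed_measurable_set_ae sf mE; exists (B, N).
have [BN BNP] := choice rep.
pose N := \bigcup_n (BN n).2.
have mN : measurable N.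
  by apply: bigcupT_measurable => q; have [] := BNP q.
have N0 : mu N = 0%E.
  apply/negligibleP => //; apply: negligible_bigcup => n.
  by have [_ m0 n0 _] := BNP n; exact/negligibleP.
pose g x := if x \in N then 0 else f x.
exists g, N; split => //; last by move=> x Nx; rewrite /g memNset.
apply: (measurability _ (RGenOInfty.measurableE R)) => _ [_ [r ->] <-].
rewrite setTI.
have -> : g @^-1` `]r, +oo[ = (~` N `&`
    \bigcup_(n in [set n | r < ratr (rat_seq n)]) (BN n).1) `|`
    (N `&` [set _ | r < 0]).
  apply/seteqP; split => x /=; rewrite /g in_itv/= andbT.
    case: ifPn => [/set_mem Nx r0|/negP Nx rf]; first by right.
    have {}Nx : ~ N x by move=> ?; apply: Nx; exact: mem_set.
    left; split => //; have [q /andP[rq qf]] := rat_in_itvoo rf.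
    have qE : rat_seq (pickle q) = q by rewrite /rat_seq pickleK.
    exists (pickle q); first by rewrite /= qE.
    have [_ _ _ h] := BNP (pickle q).
    apply/h; first by move=> ?; apply: Nx; exists (pickle q).
    by rewrite /= qE in_itv/= andbT.
  move=> [[Nx [n /= rq Bx]]|[Nx r0]]; last by rewrite mem_set.
  rewrite memNset//; apply: lt_trans rq _.
  have [_ _ _ h] := BNP n.
  have := (h x _).2 Bx; rewrite /= in_itv/= andbT; apply.
  by move=> ?; apply: Nx; exists n.
apply: measurableU; last first.
  apply: measurableI => //; have [r0|r0] := boolP (r < 0).
    by rewrite (_ : [set _ | _] = setT)//; apply/seteqP; split.
  by rewrite (_ : [set _ | _] = set0)//; apply/seteqP; split.
apply: measurableI; first exact: measurableC.
by apply: bigcup_measurable => n _; have [] := BNP n.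
Qed.

End completion.

(** * One-dimensional integrals *)

Section one_dimensional_integrals.
Context (R : realType).
Local Notation lambda := (@lebesgue_measure R).

Lemma measurable_affine (b c : R) : measurable_fun setT (fun t : R => b + c * t).
Proof. by apply: measurable_funD => //; exact: measurable_funM. Qed.

(** Both sides are measures, so that it suffices to compare them on the
    intervals ]x, y]. *)
Lemma lebesgue_measure_affine_pos (b c : R) (A : set R) : 0 < c -> measurable A ->
  lambda ((fun t => b + c * t) @^-1` A) = (c^-1%:E * lambda A)%E.
Proof.
move=> c0 mA.
pose T (t : measurableTypeR R) : measurableTypeR R := b + c * t.
have mT : measurable_fun setT T by exact: measurable_affine.
pose c' : {nonneg R} := NngNum (ltW c0).
pose m : {measure set (measurableTypeR R) -> \bar R} :=
  mscale c' (measure_function_pushforward__canonical__measure_function_Measure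
    lambda mT).
have -> : lambda A = m A.
  apply: lebesgue_measure_unique => // _ [[x y] _ <-].
  rewrite /m/= /mscale/= /pushforward lebesgue_measure_itv/=.
  have -> : T @^-1` `]x, y]%classic = `](x - b) / c, (y - b) / c]%classic.
    apply/seteqP; split => t; rewrite /T /= !in_itv/=;
    by rewrite ltr_pdivrMr// ler_pdivlMr// ltrBlDl lerBrDl (mulrC t).
  rewrite lebesgue_measure_itv/= !lte_fin ltr_pM2r ?invr_gt0// ltrD2r.
  case: ifP => _; last by rewrite mule0.
  by rewrite -!EFinD -EFinM; congr EFin; field; rewrite gt_eqF.
by rewrite /m/= /mscale/= muleA -EFinM mulVf ?gt_eqF// mul1e.
Qed.

Lemma lebesgue_measure_affine (b c : R) (A : set R) : c != 0 -> measurable A ->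
  lambda ((fun t => b + c * t) @^-1` A) = (`|c|^-1%:E * lambda A)%E.
Proof.
move=> c0 mA; have [c_gt0|c_le0] := ltP 0 c.
  by rewrite gtr0_norm// lebesgue_measure_affine_pos.
have c_lt0 : 0 < - c by rewrite oppr_gt0 lt_neqAle c0.
rewrite ler0_norm// -(lebesgue_measure_affine_pos b)// -[RHS]lebesgue_measureN.
  congr (lambda _); apply/seteqP.
  by split => t; rewrite /= mulrNN.
rewrite -[_ @^-1` _]setTI; exact: measurable_affine.
Qed.

Lemma ge0_integral_scale (c : R) (f : R -> \bar R) : 0 < c ->
  measurable_fun setT f -> (forall t, 0 <= f t)%E ->
  (\int[lambda]_t f (c * t)%R = c^-1%:E * \int[lambda]_t f t)%E.
Proof.
move=> c0 mf f0.
pose T (t : measurableTypeR R) : measurableTypeR R := 0 + c * t.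
have mT : measurable_fun setT T by exact: measurable_affine.
have ci0 : 0 <= c^-1 by rewrite invr_ge0 ltW.
have -> : (\int[lambda]_t f (c * t)%R = \int[lambda]_t (f \o T) t)%E.
  by apply: eq_integral => t _; rewrite /T /= add0r.
rewrite -[setT in LHS](preimage_setT T) -ge0_integral_pushforward//.
rewrite -(@ge0_integral_mscale _ _ _ lambda _ _ (NngNum ci0))//.
apply: eq_measure_integral => A mA _ /=.
by rewrite /mscale /pushforward/= lebesgue_measure_affine_pos.
Qed.

(** This is the Beta value B (1/2, a - 1/2), the integral of a power of the
    Japanese bracket of t. *)
Definition japanese_integral (a : R) : \bar R :=
  (\int[lambda]_t ((1 + t ^+ 2) `^ (- a))%:E)%E.
Local Notation K := japanese_integral.

Lemma measurable_japanese (q a : R) :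
  measurable_fun setT (fun t : R => (q + t ^+ 2) `^ (- a)).
Proof.
apply: (measurableT_comp (f := @powR R ^~ (- a))); first exact: measurable_powR.
by apply: measurable_funD => //; exact: measurable_funX.
Qed.

Lemma japanese_integral_ge0 a : (0 <= K a)%E.
Proof. by apply: integral_ge0 => t _; rewrite lee_fin powR_ge0. Qed.

(** The dilation t = sqrt q * r. *)
Lemma integral_japanese_scale (q a : R) : 0 < q ->
  (\int[lambda]_t ((q + t ^+ 2) `^ (- a))%:E = (q `^ (2^-1 - a))%:E * K a)%E.
Proof.
move=> q0; pose r := Num.sqrt q.
have r0 : 0 < r by rewrite sqrtr_gt0.
have q_neq0 : q != 0 by rewrite gt_eqF.
have rr : r ^+ 2 = q by rewrite sqr_sqrtr// ltW.
have := @ge0_integral_scale r (fun t => ((q + t ^+ 2) `^ (- a))%:E) r0.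
have -> : (\int[lambda]_t ((q + (r * t)%R ^+ 2) `^ (- a))%:E =
    (q `^ (- a))%:E * K a)%E.
  rewrite -ge0_integralZl_EFin//.
  - apply: eq_integral => t _; rewrite exprMn rr -EFinM -powRM.
    + by rewrite mulrDr mulr1.
    + exact: ltW.
    + by rewrite addr_ge0// sqr_ge0.
  - by move=> t _; rewrite lee_fin powR_ge0.
  - by apply/measurable_EFinP; exact: measurable_japanese.
  - exact: powR_ge0.
move=> H; have {}H := H _ _.
have -> : q `^ (2^-1 - a) = r * q `^ (- a).
  by rewrite powRD ?q_neq0 ?implybT// powR12_sqrt// ltW.
rewrite EFinM -muleA H; last 2 first.
- by apply/measurable_EFinP; exact: measurable_japanese.
- by move=> t; rewrite lee_fin powR_ge0.
by rewrite muleA -EFinM divff ?gt_eqF// mul1e.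
Qed.

(** The integrand is at most 1 / (1 + t^2), the derivative of the arctangent. *)
Lemma japanese_integral_fin a : 1 <= a -> (K a < +oo)%E.
Proof.
move=> a1.
have bound : (K a <= \int[lambda]_t ((oneDsqr t)^-1)%:E)%E.
  apply: ge0_le_integral => //.
  - by move=> t _; rewrite lee_fin powR_ge0.
  - by apply/measurable_EFinP; exact: measurable_japanese.
  - apply/measurable_EFinP; apply: continuous_measurable_fun.
    exact: continuous_oneDsqrV.
  move=> t _; rewrite lee_fin /oneDsqr -powR_inv1 ?addr_ge0 ?sqr_ge0//.
  by apply: ler_powR; [rewrite lerDl sqr_ge0|rewrite lerN2].
apply: le_lt_trans bound _.
rewrite ge0_symfun_integralT//=.
- rewrite (_ : [set x | _] = `[0, +oo[%classic); last first.
    by apply/seteqP; split => x/=; rewrite in_itv/= andbT.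
  by rewrite integral0y_oneDsqr -EFinM ltry.
- exact: continuous_oneDsqrV.
- by move=> x/=; rewrite /oneDsqr sqrrN.
Qed.

Lemma japanese_integral_gt0 a : 0 <= a -> (0 < K a)%E.
Proof.
move=> a0.
apply: (@lt_le_trans _ _ (\int[lambda]_(t in `[0%R, 1%R]) (2 `^ (- a))%:E)%E).
  have l01 : lambda (`[0, 1]%classic : set R) = 1%E.
    by rewrite lebesgue_measure_itv/= lte_fin ltr01 oppr0 adde0.
  by rewrite integral_cst// [X in (_ * X)%E]l01 mule1 lte_fin powR_gt0.
apply: (@le_trans _ _
    (\int[lambda]_(t in `[0%R, 1%R]) ((1 + t ^+ 2) `^ (- a))%:E)%E).
  apply: ge0_le_integral => //.
  - apply/measurable_EFinP; apply: (@measurable_funTS _ _ _ _ _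
      (fun t : R => (1 + t ^+ 2) `^ (- a))); exact: measurable_japanese.
  move=> t; rewrite /= in_itv/= => /andP[t0 t1].
  have t21 : t ^+ 2 <= 1 by rewrite expr_le1.
  rewrite lee_fin !powRN lef_pV2 ?posrE ?powR_gt0 ?ltr_pwDl ?sqr_ge0//.
  rewrite ge0_ler_powR// ?nnegrE ?addr_ge0 ?sqr_ge0//.
  by rewrite [leRHS](_ : 2 = 1 + 1)// lerD2l.
apply: ge0_subset_integral => //.
  by apply/measurable_EFinP; exact: measurable_japanese.
by move=> t _; rewrite lee_fin powR_ge0.
Qed.

Lemma integral_gauss_scale (r : R) : 0 < r ->
  (\int[lambda]_t (expR (- (r * t ^+ 2)))%:E =
   (r `^ (- 2^-1) * Num.sqrt pi)%:E)%E.
Proof.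
move=> r0; pose q := Num.sqrt r.
have q0 : 0 < q by rewrite sqrtr_gt0.
have := @ge0_integral_scale q (fun t => (gauss_fun t)%:E) q0.
rewrite integralT_gauss powRN powR12_sqrt ?(ltW r0)// EFinM => <-.
- by apply: eq_integral => t _; rewrite /gauss_fun exprMn sqr_sqrtr// ltW.
- by apply/measurable_EFinP; exact: measurable_gauss_fun.
- by move=> t; rewrite lee_fin gauss_fun_ge0.
Qed.

Definition gamma_integral (a : R) : \bar R :=
  (\int[lambda]_(t in `]0%R, +oo[) (t `^ (a - 1) * expR (- t))%:E)%E.
Local Notation G := gamma_integral.

Let gamma_integrand (a c t : R) : R :=
  \1_(`]0, +oo[) t * (t `^ (a - 1) * expR (- (c * t))).

Let gamma_integrand_ge0 a c t : 0 <= gamma_integrand a c t.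
Proof. by rewrite /gamma_integrand !mulr_ge0 ?powR_ge0 ?expR_ge0. Qed.

Let measurable_gamma_integrand a c : measurable_fun setT (gamma_integrand a c).
Proof.
apply: measurable_funM; first exact: measurable_indic.
apply: measurable_funM; first exact: measurable_powR.
by apply: (measurableT_comp (@measurable_expR _)); exact: measurableT_comp.
Qed.

Let gamma_integralE a : G a = (\int[lambda]_t (gamma_integrand a 1 t)%:E)%E.
Proof.
rewrite /G integral_mkcond; apply: eq_integral => t _.
rewrite patchE /gamma_integrand indicE mul1r.
by case: ifP => _; rewrite ?mul1r ?mul0r.
Qed.

Let gamma_integrand_scale a c : 0 < c ->
  (\int[lambda]_t (gamma_integrand a c t)%:E = (c `^ (- a))%:E * G a)%E.
Proof.
move=> c0; have c_neq0 : c != 0 by rewrite gt_eqF.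
have : (\int[lambda]_t (gamma_integrand a 1 (c * t))%:E =
   (c `^ (a - 1))%:E * \int[lambda]_t (gamma_integrand a c t)%:E)%E.
  rewrite -ge0_integralZl_EFin ?powR_ge0//; first last.
  - by apply/measurable_EFinP; exact: measurable_gamma_integrand.
  - by move=> t _; rewrite lee_fin.
  apply: eq_integral => t _.
  rewrite -EFinM /gamma_integrand !indicE !mem_setE.
  rewrite !in_itv/= !andbT pmulr_rgt0// mul1r.
  have [t0|_] := ltP 0 t; last by rewrite !mul0r mulr0.
  by rewrite powRM ?(ltW c0) ?(ltW t0)// !mul1r mulrA.
rewrite (@ge0_integral_scale c (fun t => (gamma_integrand a 1 t)%:E))//; first last.
- by move=> t; rewrite lee_fin.
- by apply/measurable_EFinP; exact: measurable_gamma_integrand.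
rewrite -gamma_integralE => /(congr1 (fun z => (c `^ (1 - a))%:E * z)%E).
rewrite !muleA -!EFinM -powRD ?c_neq0 ?implybT//.
rewrite addrA subrK subrr powRr0 mul1e => <-; congr (EFin _ * _)%E.
rewrite -powR_inv1 ?ltW// -powRD ?c_neq0 ?implybT//; congr (_ `^ _); lra.
Qed.

(** Tonelli for the integral of r^(a-1) exp (- (1 + t^2) r) over r > 0 and t.
    Integrating in r first gives Gamma(a) (1 + t^2)^-a by a dilation; integrating
    in t first gives a Gaussian integral, sqrt (pi / r).  The identity holds in
    the extended reals, so that no case distinction on the convergence of the
    Gamma integrals arises. *)
Lemma gamma_japanese_integral a :
  (G a * K a = (Num.sqrt pi)%:E * G (a - 2^-1))%E.
Proof.
pose F (x : R * R) : \bar R := (gamma_integrand a (1 + x.1 ^+ 2) x.2)%:E.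
have mF : measurable_fun setT F.
  apply/measurable_EFinP; apply: measurable_funM.
    apply: (measurableT_comp (f := (\1_(`]0, +oo[%classic) : R -> R)));
      last exact: measurable_snd.
    exact: measurable_indic.
  apply: measurable_funM.
    apply: (measurableT_comp (f := @powR R ^~ (a - 1))).
      exact: measurable_powR.
    exact: measurable_snd.
  apply: (measurableT_comp (@measurable_expR _)); apply: measurableT_comp => //.
  apply: measurable_funM; last exact: measurable_snd.
  apply: measurable_funD => //.
  exact: (measurableT_comp (exprn_measurable _) measurable_fst).
have F0 x : (0 <= F x)%E by rewrite lee_fin.
have G0 : (0 <= G a)%E.
  by rewrite gamma_integralE; apply: integral_ge0 => t _; rewrite lee_fin.
transitivity (\int[lambda]_t \int[lambda]_r F (t, r))%E.
  rewrite muleC /K -ge0_integralZr//.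
  - apply: eq_integral => t _.
    by rewrite /F /= gamma_integrand_scale// ltr_pwDl ?sqr_ge0.
  - by apply/measurable_EFinP; exact: measurable_japanese.
  - by move=> t _; rewrite lee_fin powR_ge0.
rewrite (@fubini_tonelli _ _ _ _ _ lambda lambda F)// gamma_integralE.
rewrite -ge0_integralZl_EFin ?sqrtr_ge0//; first last.
- by apply/measurable_EFinP; exact: measurable_gamma_integrand.
- by move=> t _; rewrite lee_fin.
apply: eq_integral => r _; rewrite /F /=.
have [r0|r0] := ltP 0 r; last first.
  rewrite /gamma_integrand !indicE !mem_setE in_itv/= andbT ltNge r0/=.
  rewrite mul0r mule0; apply: integral0_eq => t _.
  by rewrite mul0r.
under eq_integral => t _.
  have -> : gamma_integrand a (1 + t ^+ 2) r =
      (r `^ (a - 1) * expR (- r)) * expR (- (r * t ^+ 2)).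
    rewrite /gamma_integrand indicE mem_setE in_itv/= r0/= mul1r -mulrA -expRD.
    by congr (_ * expR _); ring.
  rewrite EFinM.
  over.
rewrite ge0_integralZl_EFin//; last 2 first.
- apply/measurable_EFinP; apply: (measurableT_comp (@measurable_expR _)).
  by apply: measurableT_comp => //; apply: measurable_funM => //.
- by rewrite mulr_ge0 ?powR_ge0 ?expR_ge0.
rewrite integral_gauss_scale// -EFinM; congr EFin.
rewrite /gamma_integrand indicE mem_setE in_itv/= r0/= !mul1r.
have -> : a - 2^-1 - 1 = (a - 1) + (- 2^-1) by lra.
rewrite [r `^ (a - 1 - _)]powRD ?(gt_eqF r0) ?implybT//; ring.
Qed.

(** An infinite Gamma integral has 0 for its real value; as K(a) is positive and
    finite, the two Gamma integrals in [gamma_japanese_integral] are infinite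
    together. *)
Lemma Gamma_pos_japanese a : (K a < +oo)%E -> (0 < K a)%E ->
  Gamma_pos a * fine (K a) = Num.sqrt pi * Gamma_pos (a - 2^-1).
Proof.
move=> Koo K0; have Kfin : K a \is a fin_num by rewrite ge0_fin_numE// ltW.
have pi0 : 0 < Num.sqrt pi :> R by rewrite sqrtr_gt0 pi_gt0.
have := gamma_japanese_integral a; rewrite -(fineK Kfin).
rewrite /Gamma_pos /Rintegral -/(G a) -/(G (a - 2^-1)).
have fK : 0 < fine (K a) by rewrite fine_gt0// K0 Koo.
case: (G a) => [x| |]; case: (G (a - 2^-1)) => [y| |] //=.
- by rewrite -!EFinM => -[].
all: by rewrite ?mul0r ?mulr0// ?gt0_mulye ?gt0_mulNye ?gt0_muley ?gt0_muleNy.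
Qed.

End one_dimensional_integrals.

(** * Lebesgue measure on row vectors *)

Section row_vectors.
Context (R : realType).
Local Notation lambda := (@lebesgue_measure R).

Definition init d : 'rV[R]_d.+1 -> 'rV[R]_d := first_coords (ltnSn d).

Lemma widen_ord_max d (i : 'I_d) :
  widen_ord (ltnW (ltnSn d)) i = lift ord_max i.
Proof. by apply: val_inj; rewrite /= /bump leqNgt ltn_ord. Qed.

Lemma init_row_rcons d (x : 'rV[R]_d) t : init (row_rcons (x, t)) = x.
Proof. by apply/rowP => i; rewrite !mxE widen_ord_max liftK. Qed.

Lemma row_rcons_max d (x : 'rV[R]_d) t : row_rcons (x, t) 0 ord_max = t.
Proof. by rewrite mxE unlift_none. Qed.

Lemma row_rcons_init d (z : 'rV[R]_d.+1) : row_rcons (init z, z 0 ord_max) = z.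
Proof.
apply/rowP => i; rewrite mxE; case: unliftP => [j ->|->] //.
by rewrite mxE widen_ord_max.
Qed.

Lemma row_rconsD d (x y : 'rV[R]_d) a b (c : R) :
  row_rcons (x, a) + c *: row_rcons (y, b) = row_rcons (x + c *: y, a + c * b).
Proof. by apply/rowP => i; rewrite !mxE; case: unliftP => [j|] _; rewrite ?mxE. Qed.

Lemma measurable_rV d0 (T : measurableType d0) d (f : T -> 'rV[R]_d) :
  (forall i, measurable_fun setT (fun x => f x 0 i)) -> measurable_fun setT f.
Proof.
move=> mf; pose coord (i : 'I_d) (x : 'rV[R]_d) : R := x 0 i.
apply: (measurability
  (\big[setU/set0]_(i < d) preimage_set_system setT (coord i) measurable)).
  by [].
move=> _ [B + <-]; rewrite -bigcup_seq => -[i _] [Y mY <-].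
by rewrite !setTI; have := mf i measurableT Y mY; rewrite setTI.
Qed.

Lemma measurable_init d : measurable_fun setT (@init d).
Proof.
apply: measurable_rV => i; under eq_fun do rewrite mxE.
exact: measurable_coord.
Qed.

Lemma measurable_rV_affine d (x : 'rV[R]_d) (c : R) :
  measurable_fun setT (fun y : 'rV[R]_d => x + c *: y).
Proof.
apply: measurable_rV => i; under eq_fun do rewrite !mxE.
by apply: measurable_funD => //; apply: measurable_funM => //; exact: measurable_coord.
Qed.

Lemma borel_lebesgue_sigma_finite d : sigma_finite setT (borel_lebesgue R d).
Proof.
elim: d => [|d [F TF mF]].
  exists (fun _ => setT); first by rewrite bigcup_const.
  by move=> _; split => //=; rewrite diracT ltry.
have /sigma_finiteP[G [TG ndG mG]] := sigma_finiteT lambda.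
have [F' [TF' ndF mF']] : exists F', [/\ [set: 'rV[R]_d] = \bigcup_i F' i,
    nondecreasing_seq F' &
    forall i, measurable (F' i) /\ (borel_lebesgue R d (F' i) < +oo)%E].
  by apply/sigma_finiteP; exists F.
pose split (z : 'rV[R]_d.+1) := (init z, z 0 ord_max).
have msplit : measurable_fun setT split.
  by apply: measurable_fun_pair; [exact: measurable_init|exact: measurable_coord].
exists (fun n => split @^-1` (F' n `*` G n)).
  apply/seteqP; split => // z _.
  have : [set: 'rV[R]_d] (init z) by []. rewrite TF' => -[n _ Fn].
  have : [set: R] (z 0 ord_max) by []. rewrite TG => -[m _ Gm].
  exists (maxn n m) => //; split => /=.
    by move: Fn; apply/subsetPset/ndF/leq_maxl.
  by move: Gm; apply/subsetPset/ndG/leq_maxr.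
move=> n; have [mFn Fn] := mF' n; have [mGn Gn] := mG n; split.
  by rewrite -[_ @^-1` _]setTI; apply: msplit => //; exact: measurableX.
rewrite /= /borel_lebesgue_step /pushforward.
rewrite [X in (_ \x _)%E X](_ : _ = F' n `*` G n).
  by rewrite product_measure1E// lte_mul_pinfty// ge0_fin_numE.
by apply/seteqP; split => -[x t] /=; rewrite /split init_row_rcons row_rcons_max.
Qed.

(** The fixpoint [borel_lebesgue] returns a bundled measure, to which no further
    structure can be attached; this copy of the bare set function carries the
    sigma-finiteness that Tonelli's theorem asks for. *)
Definition sf_lebesgue d : set 'rV[R]_d -> \bar R := borel_lebesgue R d.
Arguments sf_lebesgue : clear implicits.

Let sf_lebesgue0 d : sf_lebesgue d set0 = 0%E.
Proof. exact: (measure0 (borel_lebesgue R d)). Qed.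

Let sf_lebesgue_ge0 d A : (0 <= sf_lebesgue d A)%E.
Proof. exact: (measure_ge0 (borel_lebesgue R d)). Qed.

Let sf_lebesgue_sigma_additive d : semi_sigma_additive (sf_lebesgue d).
Proof. exact: (@measure_semi_sigma_additive _ _ _ (borel_lebesgue R d)). Qed.

HB.instance Definition _ d := isMeasure.Build _ _ _ (sf_lebesgue d)
  (sf_lebesgue0 d) (@sf_lebesgue_ge0 d) (sf_lebesgue_sigma_additive (d := d)).

Let sf_lebesgue_sigma_finite d : sigma_finite setT (sf_lebesgue d).
Proof. exact: borel_lebesgue_sigma_finite. Qed.

HB.instance Definition _ d := Measure_isSigmaFinite.Build _ _ _
  (sf_lebesgue d) (sf_lebesgue_sigma_finite d).

Lemma borel_lebesgue_tonelli d (F : 'rV[R]_d.+1 -> \bar R) :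
  measurable_fun setT F -> (forall z, 0 <= F z)%E ->
  (\int[borel_lebesgue R d.+1]_z F z =
   \int[borel_lebesgue R d]_x \int[lambda]_t F (row_rcons (x, t)))%E.
Proof.
move=> mF F0.
pose phi : 'rV[R]_d * R -> 'rV[R]_d.+1 := @row_rcons R d.
have mphi : measurable_fun setT phi by exact: measurable_row_rcons.
have mFphi : measurable_fun setT (F \o phi) by exact: measurableT_comp.
rewrite (eq_measure_integral
  (measure_function_pushforward__canonical__measure_function_Measure
    (sf_lebesgue d \x lambda)%E mphi)); last by [].
rewrite ge0_integral_pushforward// preimage_setT.
rewrite (@fubini_tonelli1 _ _ _ _ _ (sf_lebesgue d) lambda (F \o phi))//.
by move=> z; exact: F0.
Qed.

Lemma borel_lebesgue_step_section d (A : set 'rV[R]_d.+1) :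
  borel_lebesgue R d.+1 A =
  (\int[borel_lebesgue R d]_x lambda [set t | A (row_rcons (x, t))])%E.
Proof.
apply: eq_integral => x _; congr (lambda _); apply/seteqP.
by split => t /=; rewrite /xsection/= in_setE.
Qed.

Lemma measurable_lebesgue_section d (A : set 'rV[R]_d.+1) : measurable A ->
  measurable_fun setT (fun x : 'rV[R]_d => lambda [set t | A (row_rcons (x, t))]).
Proof.
move=> mA.
have mB : measurable (@row_rcons R d @^-1` A).
  by rewrite -[_ @^-1` _]setTI; exact: measurable_row_rcons.
have := measurable_fun_xsection lambda mB; congr (measurable_fun _ _).
apply/funext => x /=; congr (lambda _); apply/seteqP.
by split => t /=; rewrite /xsection/= in_setE.
Qed.

Lemma borel_lebesgue_null_sections d (A : set 'rV[R]_d.+1) : measurable A ->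
  borel_lebesgue R d.+1 A = 0%E ->
  exists N, [/\ measurable N, borel_lebesgue R d N = 0%E &
    forall x, ~ N x -> lambda [set t | A (row_rcons (x, t))] = 0%E].
Proof.
move=> mA; rewrite borel_lebesgue_step_section => A0.
have mphi := measurable_lebesgue_section mA.
have := (ae_eq_integral_abs (borel_lebesgue R d) measurableT mphi).1.
under eq_integral do rewrite gee0_abs//.
move=> /(_ A0) [N [mN N0 sub]]; exists N; split => // x Nx.
apply: contrapT => h; apply: Nx; apply: sub => /= /(_ I); exact: h.
Qed.

(** Tonelli in the other order: almost every t has a null slice, and the line is
    not null. *)
Lemma borel_lebesgue_null_slice d (A : set 'rV[R]_d.+1) : measurable A ->
  borel_lebesgue R d.+1 A = 0%E ->
  exists t, measurable [set x | A (row_rcons (x, t))] /\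
    borel_lebesgue R d [set x | A (row_rcons (x, t))] = 0%E.
Proof.
move=> mA A0.
have mB : measurable (@row_rcons R d @^-1` A).
  by rewrite -[_ @^-1` _]setTI; exact: measurable_row_rcons.
pose f (z : 'rV[R]_d * R) : \bar R := (\1_(@row_rcons R d @^-1` A) z)%:E.
have mf : measurable_fun setT f by apply/measurable_EFinP; exact: measurable_indic.
have f0 z : (0 <= f z)%E by rewrite lee_fin.
have sliceE t : (\int[sf_lebesgue d]_x f (x, t) =
    borel_lebesgue R d [set x | A (row_rcons (x, t))])%E.
  rewrite -[LHS]/(fubini_G (sf_lebesgue d) f t) indic_fubini_tonelli_GE//=.
  by congr (sf_lebesgue d _); apply/seteqP; split => x /=; rewrite /ysection/= in_setE.
have mslice := measurable_fun_fubini_tonelli_G (m1 := sf_lebesgue d) f mf f0.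
have : (\int[lambda]_t `|fubini_G (sf_lebesgue d) f t| = 0)%E.
  under eq_integral do rewrite gee0_abs ?integral_ge0//.
  rewrite -[LHS](fubini_tonelli2 (m2 := lambda) f mf f0) integral_indic// setIT.
  exact: A0.
move=> /(ae_eq_integral_abs lambda measurableT mslice)[N [mN N0 sub]].
have [t Nt] : exists t, ~ N t.
  apply: contrapT => /forallNP NT.
  have : N = setT by apply/seteqP; split => // t _; apply: contrapT; exact: NT.
  move=> NE; move: N0; rewrite NE => lT.
  have l01 : lambda (`[0, 1]%classic : set R) = 1%E.
    by rewrite lebesgue_measure_itv/= lte_fin ltr01 oppr0 adde0.
  suff : (1%E <= lambda setT)%E by rewrite lT lee_fin ler10.
  by rewrite -l01; apply: le_measure; rewrite ?inE.
exists t; split.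
  have := measurable_ysection t mB; congr (measurable _).
  by apply/seteqP; split => x /=; rewrite /ysection/= in_setE.
rewrite -sliceE; apply: contrapT => h; apply: Nt; apply: sub => /= /(_ I); exact: h.
Qed.

(** Induction on the dimension: for almost every y the slice of N above
    x' + c y is null by induction, hence so is its preimage under the affine map
    t |-> x_d + c t. *)
Lemma borel_lebesgue_null_affine d (x : 'rV[R]_d) (c : R) (N : set 'rV[R]_d) :
  c != 0 -> measurable N -> borel_lebesgue R d N = 0%E ->
  borel_lebesgue R d ((fun y => x + c *: y) @^-1` N) = 0%E.
Proof.
move=> c0; elim: d => [|d IH] in x N *.
  move=> _ N0; rewrite -[RHS]N0; congr (borel_lebesgue R 0 _).
  by apply/seteqP; split => y /=; rewrite (thinmx0 (_ + _)) (thinmx0 y).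
move=> mN N0; have [M [mM M0 sec]] := borel_lebesgue_null_sections mN N0.
have {IH} M'0 := IH (init x) M mM M0.
set M' := (X in borel_lebesgue R d X = _) in M'0.
have mM' : measurable M'.
  by rewrite -[M']setTI; exact: measurable_rV_affine.
set A := _ @^-1` N; have mA : measurable A.
  by rewrite -[A]setTI; exact: measurable_rV_affine.
rewrite borel_lebesgue_step_section.
apply/eqP; rewrite eq_le integral_ge0// andbT.
rewrite (@ge0_ae_eq_integral _ _ _ _ setT _ (cst 0%E)) ?integral0//.
  exact: measurable_lebesgue_section.
exists M'; split => // y /= h; apply: contrapT => M'y; apply: h => _.
have mS : measurable [set t | N (row_rcons (init x + c *: y, t))].
  have mB : measurable (@row_rcons R d @^-1` N).
    by rewrite -[_ @^-1` _]setTI; exact: measurable_row_rcons.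
  have := measurable_xsection (init x + c *: y) mB; congr (measurable _).
  by apply/seteqP; split => t /=; rewrite /xsection/= in_setE.
have := lebesgue_measure_affine (x 0 ord_max) c0 mS.
rewrite sec// mule0 => <-; congr (lambda _).
have xyE t : x + c *: row_rcons (y, t) =
    row_rcons (init x + c *: y, x 0 ord_max + c * t).
  by rewrite -row_rconsD row_rcons_init.
by apply/seteqP; split => t /=; rewrite /A/= xyE.
Qed.

Lemma borel_lebesgue_null_cylinder d (N : set 'rV[R]_d) :
  measurable N -> borel_lebesgue R d N = 0%E ->
  borel_lebesgue R d.+1 (@init d @^-1` N) = 0%E.
Proof.
move=> mN N0; rewrite /= /borel_lebesgue_step /pushforward.
rewrite [X in (_ \x _)%E X](_ : _ = N `*` setT).
  by rewrite product_measure1E// [X in (X * _)%E]N0 mul0e.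
by apply/seteqP; split => -[x t] /=; rewrite init_row_rcons// => -[].
Qed.

End row_vectors.

(** * Integrals of cylindrical functions *)

Section cylinders.
Context (R : realType).
Local Notation lambda := (@lebesgue_measure R).
Local Notation K := (@japanese_integral R).

Lemma initD d (x y : 'rV[R]_d.+1) : init (x + y) = init x + init y.
Proof. by apply/rowP => i; rewrite !mxE. Qed.

Lemma initZ d (c : R) (x : 'rV[R]_d.+1) : init (c *: x) = c *: init x.
Proof. by apply/rowP => i; rewrite !mxE. Qed.

Lemma lebesgue_measurableP d (f : 'rV[R]_d -> R) :
  measurable_fun [set: lebesgueRd R d] f <-> ae_measurable (borel_lebesgue R d) f.
Proof.
split; last exact: ae_measurable_completed.
exact/completed_measurable_ae/borel_lebesgue_sigma_finite.
Qed.

Lemma borel_lebesgue_measurable d (f : 'rV[R]_d -> R) :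
  measurable_fun [set: 'rV[R]_d] f -> measurable_fun [set: lebesgueRd R d] f.
Proof.
move=> mf; apply/lebesgue_measurableP; exists f, set0.
by split => //; rewrite measure0.
Qed.

Lemma lebesgue_measurable_affine d (f : 'rV[R]_d -> R) (x : 'rV[R]_d) (c : R) :
  measurable_fun [set: lebesgueRd R d] f ->
  measurable_fun [set: lebesgueRd R d] (fun y => f (x + c *: y)).
Proof.
have [-> _|c0] := eqVneq c 0.
  by under eq_fun do rewrite scale0r addr0; exact: measurable_cst.
move=> /lebesgue_measurableP[g [N [mg mN N0 fg]]]; apply/lebesgue_measurableP.
have mT := measurable_rV_affine x c.
exists (fun y => g (x + c *: y)), ((fun y => x + c *: y) @^-1` N); split.
- exact: measurableT_comp.
- by rewrite -[_ @^-1` _]setTI; exact: mT.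
- exact: borel_lebesgue_null_affine.
- by move=> y /= /fg.
Qed.

(** For the converse, an almost everywhere equality between v (init z) and a Borel
    function of z is restricted to a hyperplane z_d = t that meets the exceptional
    set in a null set. *)
Lemma lebesgue_measurable_init d (v : 'rV[R]_d -> R) :
  measurable_fun [set: lebesgueRd R d] v <->
  measurable_fun [set: lebesgueRd R d.+1] (v \o @init R d).
Proof.
split => /lebesgue_measurableP[g [N [mg mN N0 vg]]]; apply/lebesgue_measurableP.
  exists (g \o @init R d), (@init R d @^-1` N); split.
  - by apply: measurableT_comp => //; exact: measurable_init.
  - by rewrite -[_ @^-1` _]setTI; exact: measurable_init.
  - exact: borel_lebesgue_null_cylinder.
  - by move=> z /= /vg.
have [t [mNt Nt0]] := borel_lebesgue_null_slice mN N0.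
exists (fun x => g (row_rcons (x, t))), [set x | N (row_rcons (x, t))].
split => //; last by move=> x /= /vg <-; rewrite /= init_row_rcons.
apply: (measurableT_comp mg); apply: (measurableT_comp (@measurable_row_rcons R d)).
by apply: measurable_fun_pair => //; exact: measurable_cst.
Qed.

(** The completed measure restricts to the original one on Borel sets, that is,
    the identity map pushes it forward to the Borel measure. *)
Lemma lebesgue_integralE d (f g : 'rV[R]_d -> R) (N : set 'rV[R]_d) :
  measurable_fun setT g -> measurable N -> borel_lebesgue R d N = 0%E ->
  (forall x, ~ N x -> f x = g x) ->
  (\int[lebesgue R d]_x (f x)%:E = \int[borel_lebesgue R d]_x (g x)%:E)%E.
Proof.
move=> mg mN N0 fg.
have mf : measurable_fun [set: lebesgueRd R d] f.
  by apply/lebesgue_measurableP; exists g, N.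
have mgL : measurable_fun [set: lebesgueRd R d] g by exact: borel_lebesgue_measurable.
rewrite (@ae_eq_integral _ _ _ (lebesgue R d) setT (EFin \o g) (EFin \o f))//; first last.
- exists N; split.
  + exact: completed_measurable.
  + by rewrite -N0; exact: measurable_mu_extE.
  + by move=> x /= h; apply: contrapT => /fg fgx; apply: h; rewrite /= fgx.
- exact/measurable_EFinP.
- exact/measurable_EFinP.
pose id' : lebesgueRd R d -> 'rV[R]_d := id.
have mid : measurable_fun setT id'.
  by move=> _ Y mY; rewrite setTI; exact: completed_measurable.
have nonneg (h : 'rV[R]_d -> \bar R) : measurable_fun setT h ->
    (forall x, 0 <= h x)%E ->
    (\int[lebesgue R d]_x h x = \int[borel_lebesgue R d]_x h x)%E.
  move=> mh h0.
  transitivity (\int[pushforward (lebesgue R d) id']_x h x)%E.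
    by rewrite ge0_integral_pushforward.
  apply: eq_measure_integral => A mA _ /=.
  exact: measurable_mu_extE.
rewrite integralE [RHS]integralE; congr (_ - _)%E; apply: nonneg => //.
- by apply: measurable_funepos; exact/measurable_EFinP.
- by apply: measurable_funeneg; exact/measurable_EFinP.
Qed.

Definition sqnorm d (x : 'rV[R]_d) : R := \sum_i x 0 i ^+ 2.

Lemma sqnorm_ge0 d (x : 'rV[R]_d) : 0 <= sqnorm x.
Proof. by apply: sumr_ge0 => i _; exact: sqr_ge0. Qed.

Lemma sqnorm_row_rcons d (x : 'rV[R]_d) t :
  sqnorm (row_rcons (x, t)) = sqnorm x + t ^+ 2.
Proof.
rewrite /sqnorm big_ord_recr /= row_rcons_max; congr (_ + _).
apply: eq_bigr => i _; rewrite mxE (_ : widen_ord _ i = lift ord_max i) ?liftK//.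
by rewrite -widen_ord_max; exact: val_inj.
Qed.

Lemma enorm_powR d (x : 'rV[R]_d) p : enorm x `^ p = sqnorm x `^ (p / 2).
Proof. by rewrite /enorm -powR12_sqrt ?sqnorm_ge0// -powRrM mulrC. Qed.

Lemma measurable_sqnorm d : measurable_fun setT (@sqnorm d).
Proof.
by apply: measurable_sum => i; exact: (measurable_funX _ (measurable_coord i)).
Qed.

(** Both weights of interest have this form: q = 0 is the kernel |x|^(-2a) of the
    fractional Laplacian, and q = 1 is equivalent to the weight of the class
    of admissible functions.  The common form allows a single Tonelli argument. *)
Definition weight d (q a : R) (x : 'rV[R]_d) : R := (q + sqnorm x) `^ (- a).

Lemma weight_ge0 d q a (x : 'rV[R]_d) : 0 <= weight q a x.
Proof. exact: powR_ge0. Qed.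

Lemma measurable_weight d q a : measurable_fun setT (@weight d q a).
Proof.
apply: (measurableT_comp (f := @powR R ^~ (- a))); first exact: measurable_powR.
by apply: measurable_funD => //; exact: measurable_sqnorm.
Qed.

(** Integrating out one variable lowers the exponent by 1/2, that is, turns the
    exponent (d+1)/2 + s into d/2 + s. *)
Lemma integral_weight d (q a : R) (x : 'rV[R]_d) : 0 < q + sqnorm x ->
  (\int[lambda]_t (weight q (a + 2^-1) (row_rcons (x, t)))%:E =
   (weight q a x)%:E * K (a + 2^-1))%E.
Proof.
move=> q0; rewrite /weight.
under eq_integral do rewrite sqnorm_row_rcons addrA.
rewrite integral_japanese_scale//; congr ((_ `^ _)%:E * _)%E; lra.
Qed.

Let borel_integral_cylinder_ge0 d (q a : R) (g : 'rV[R]_d -> \bar R) :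
  measurable_fun setT g -> (forall x, 0 <= g x)%E -> 0 <= q ->
  (forall x, q + sqnorm x = 0 -> g x = 0%E) ->
  (\int[borel_lebesgue R d.+1]_z (g (init z) * (weight q (a + 2^-1) z)%:E) =
   K (a + 2^-1) * \int[borel_lebesgue R d]_x (g x * (weight q a x)%:E))%E.
Proof.
move=> mg g0 q0 gq.
rewrite borel_lebesgue_tonelli; first last.
- by move=> z; rewrite mule_ge0// lee_fin weight_ge0.
- apply: emeasurable_funM; first exact: (measurableT_comp mg (@measurable_init R d)).
  by apply/measurable_EFinP; exact: measurable_weight.
rewrite -ge0_integralZl ?japanese_integral_ge0//; first last.
- by move=> x _; rewrite mule_ge0// lee_fin weight_ge0.
- apply: emeasurable_funM => //.
  by apply/measurable_EFinP; exact: measurable_weight.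
apply: eq_integral => x _.
under eq_integral do rewrite init_row_rcons.
rewrite ge0_integralZl//; first last.
- by move=> t _; rewrite lee_fin weight_ge0.
- apply/measurable_EFinP; apply: (measurableT_comp (@measurable_weight _ _ _)).
  apply: (measurableT_comp (@measurable_row_rcons R d)).
  by apply: measurable_fun_pair => //; exact: measurable_cst.
have [qx|qx] := eqVneq (q + sqnorm x) 0; first by rewrite gq// !mul0e mule0.
rewrite integral_weight ?lt_neqAle 1?eq_sym ?qx ?addr_ge0 ?sqnorm_ge0//.
by rewrite muleA muleC.
Qed.

Let scale_sub (k A B : \bar R) : (0 < k)%E -> (k < +oo)%E ->
  (0 <= A)%E -> (0 <= B)%E -> (k * A - k * B = k * (A - B))%E.
Proof.
case: k => [k| |]// k0 _; rewrite lte_fin in k0.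
case: A => [A| |]// _; case: B => [B| |]// _.
- by rewrite muleBr.
- by rewrite gt0_muley//= gt0_muleNy.
- by rewrite gt0_muley//= gt0_muley.
- by rewrite gt0_muley//= gt0_muleNy.
Qed.

(** The integrals of the positive and negative parts are multiplied by the same
    positive constant, so that the two sides agree even when they are infinite or
    of the form oo - oo.  The vanishing hypothesis concerns only
    q = 0 and x = 0, where the inner integral diverges. *)
Lemma lebesgue_integral_cylinder d (q a : R) (h : 'rV[R]_d -> R) :
  measurable_fun [set: lebesgueRd R d] h -> 0 <= q -> 2^-1 <= a ->
  (forall x, q + sqnorm x = 0 -> h x = 0) ->
  (\int[lebesgue R d.+1]_z (h (init z) * weight q (a + 2^-1) z)%:E =
   K (a + 2^-1) * \int[lebesgue R d]_x (h x * weight q a x)%:E)%E.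
Proof.
move=> /lebesgue_measurableP[g0 [N [mg0 mN N0 hg0]]] q0 a0 hq.
pose Z := [set x : 'rV[R]_d | q + sqnorm x = 0].
have mZ : measurable Z.
  rewrite (_ : Z = (fun x => q + sqnorm x) @^-1` [set 0])//.
  rewrite -[_ @^-1` _]setTI.
  by apply: (measurable_funD _ (measurable_sqnorm (d := d))).
pose g x := g0 x * \1_(~` Z) x.
have mg : measurable_fun setT g.
  by apply: measurable_funM => //; apply: measurable_indic; exact: measurableC.
have gq x : q + sqnorm x = 0 -> g x = 0.
  by move=> qx; rewrite /g indicE memNset ?mulr0//; exact.
have hg x : ~ N x -> h x = g x.
  move=> Nx; have [qx|qx] := eqVneq (q + sqnorm x) 0; first by rewrite hq// gq.
  by rewrite hg0// /g indicE mem_set ?mulr1//; exact/eqP.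
rewrite (@lebesgue_integralE _ _ (fun z => g (init z) * weight q (a + 2^-1) z)
  (@init R d @^-1` N)); first last.
- by move=> z /= /hg ->.
- exact: borel_lebesgue_null_cylinder.
- by rewrite -[_ @^-1` _]setTI; exact: measurable_init.
- apply: measurable_funM; last exact: measurable_weight.
  by apply: measurableT_comp => //; exact: measurable_init.
rewrite (@lebesgue_integralE _ _ (fun x => g x * weight q a x) N)//; first last.
- by move=> x /hg ->.
- by apply: measurable_funM => //; exact: measurable_weight.
have posE d' (f w : 'rV[R]_d' -> R) : (forall x, 0 <= w x) ->
    (fun x => (f x * w x)%:E)^\+%E =
    (fun x => (Num.max (f x) 0)%:E * (w x)%:E)%E.
  move=> w0; apply/funext => x.
  by rewrite funeposE -EFin_max -EFinM maxr_pMl// mul0r.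
have negE d' (f w : 'rV[R]_d' -> R) : (forall x, 0 <= w x) ->
    (fun x => (f x * w x)%:E)^\-%E =
    (fun x => (Num.max (- f x) 0)%:E * (w x)%:E)%E.
  move=> w0; apply/funext => x.
  by rewrite funenegE -EFinN -EFin_max -EFinM maxr_pMl// mul0r mulNr.
have mpos (f : 'rV[R]_d -> R) : measurable_fun setT f ->
    measurable_fun setT (fun x => (Num.max (f x) 0)%:E).
  by move=> mf; apply/measurable_EFinP; exact: measurable_maxr.
rewrite integralE [in RHS]integralE !posE ?negE; try exact: weight_ge0.
rewrite (borel_integral_cylinder_ge0 _ (g := fun x => (Num.max (g x) 0)%:E))//;
  first last.
- by move=> x /gq ->; rewrite maxxx.
- by move=> x; rewrite lee_fin le_max lexx orbT.
- exact: mpos.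
rewrite (borel_integral_cylinder_ge0 _ (g := fun x => (Num.max (- g x) 0)%:E))//;
  first last.
- by move=> x /gq ->; rewrite oppr0 maxxx.
- by move=> x; rewrite lee_fin le_max lexx orbT.
- by apply: mpos; exact: measurableT_comp.
apply: scale_sub.
- by apply: japanese_integral_gt0; lra.
- by apply: japanese_integral_fin; lra.
- apply: integral_ge0 => x _; rewrite mule_ge0// lee_fin ?weight_ge0//.
  by rewrite le_max lexx orbT.
- apply: integral_ge0 => x _; rewrite mule_ge0// lee_fin ?weight_ge0//.
  by rewrite le_max lexx orbT.
Qed.

End cylinders.

(** * The weighted integrability class *)

Section weighted_class.
Context (R : realType).
Local Notation K := (@japanese_integral R).

Lemma japanese_bracket_le (b z : R) : 0 <= b -> 0 <= z ->
  1 + z `^ b <= 2 * (1 + z) `^ b.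
Proof.
move=> b0 z0; rewrite [2]mulr2n mulrDl !mul1r lerD//.
  have -> : 1 = 1 `^ b :> R by rewrite powR1.
  by rewrite ge0_ler_powR ?nnegrE ?addr_ge0 ?powR1 ?lerDl.
by rewrite ge0_ler_powR ?nnegrE ?addr_ge0// lerDr.
Qed.

Lemma japanese_bracket_ge (b z : R) : 0 <= b -> 0 <= z ->
  (1 + z) `^ b <= 2 `^ b * (1 + z `^ b).
Proof.
move=> b0 z0; have [z1|z1] := leP z 1.
  apply: (@le_trans _ _ (2 `^ b)); last first.
    by rewrite ler_peMr ?powR_ge0// lerDl powR_ge0.
  by rewrite ge0_ler_powR ?nnegrE ?addr_ge0//; lra.
apply: (@le_trans _ _ ((2 * z) `^ b)); last first.
  by rewrite powRM// ler_wpM2l ?powR_ge0// lerDr.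
by rewrite ge0_ler_powR ?nnegrE ?addr_ge0 ?mulr_ge0//; lra.
Qed.

(** The integral of a nonnegative function, measurable or not, is the supremum of
    the integrals of the simple functions below it. *)
Lemma ge0_le_integral_sup d (T : measurableType d) (mu : {measure set T -> \bar R})
    (f g : T -> \bar R) :
  (forall x, 0 <= f x)%E -> (forall x, f x <= g x)%E ->
  (\int[mu]_x f x <= \int[mu]_x g x)%E.
Proof.
move=> f0 fg; rewrite !ge0_integralTE//; last first.
  by move=> x; exact: le_trans (fg x).
apply: le_ereal_sup => _ [h hf <-]; exists h => // x; exact: le_trans (fg x).
Qed.

Lemma compact_sqnorm_bounded d (C : set 'rV[R]_d) : compact C ->
  exists M, forall x, C x -> sqnorm x <= M.
Proof.
move=> /compact_bounded[M [_ CM]].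
exists (\sum_(i < d) (M + 1) ^+ 2) => x Cx; apply: ler_sum => i _.
have xM : `|x 0 i| <= M + 1.
  apply: le_trans (CM (M + 1) _ x Cx); last by rewrite ltrDl.
  by rewrite [leRHS]/Num.norm /= mx_normrE; apply/bigmax_geP; right => /=;
     exists (0, i).
by rewrite -real_normK ?num_real// lerXn2r ?nnegrE// (le_trans _ xM).
Qed.

(** The weight 1 + |x|^(d+2s) is comparable with (1 + |x|^2)^(d/2+s), for which
    [lebesgue_integral_cylinder] applies; it is bounded on compact sets, which
    gives local integrability. *)
Lemma L1sE d (s : R) (u : 'rV[R]_d -> R) : 0 < s ->
  L1s s u <-> measurable_fun [set: lebesgueRd R d] u /\
  (\int[lebesgue R d]_x (`|u x| * weight 1 (d%:R / 2 + s) x)%:E < +oo)%E.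
Proof.
move=> s0; set p := d%:R + 2 * s; set a := d%:R / 2 + s.
have p2a : p / 2 = a by rewrite /p /a; lra.
have a0 : 0 <= a by rewrite addr_ge0 ?divr_ge0 ?(ltW s0).
have z0 (x : 'rV[R]_d) := sqnorm_ge0 x.
have measurable_normu : measurable_fun [set: lebesgueRd R d] u ->
    measurable_fun [set: lebesgueRd R d] (fun x => `|u x|).
  by move=> ?; apply: (measurableT_comp (f := @Num.norm R R)).
pose w1 (x : 'rV[R]_d) := 1 + enorm x `^ p.
have w1E x : w1 x = 1 + sqnorm x `^ a by rewrite /w1 enorm_powR p2a.
have w1_gt0 x : 0 < w1 x by rewrite w1E ltr_pwDl ?powR_ge0.
have mw1 : measurable_fun [set: 'rV[R]_d] w1.
  rewrite (_ : w1 = fun x => 1 + sqnorm x `^ a); last exact/funext.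
  apply: measurable_funD => //.
  apply: (measurableT_comp (f := @powR R ^~ a)); first exact: measurable_powR.
  exact: measurable_sqnorm.
have mw1V : measurable_fun [set: 'rV[R]_d] (fun x => (w1 x)^-1).
  under eq_fun => x do rewrite -powR_inv1 ?(ltW (w1_gt0 x))//.
  by apply: (measurableT_comp (f := @powR R ^~ (-1))) => //; exact: measurable_powR.
have wE x : weight 1 a x = ((1 + sqnorm x) `^ a)^-1 by rewrite /weight powRN.
have q_gt0 x : 0 < (1 + sqnorm x) `^ a by rewrite powR_gt0// ltr_pwDl ?sqnorm_ge0.
have scale (f g : 'rV[R]_d -> R) (c : R) :
    measurable_fun [set: lebesgueRd R d] g ->
    0 <= c -> (forall x, 0 <= f x) -> (forall x, 0 <= g x) ->
    (forall x, f x <= c * g x) ->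
    (\int[lebesgue R d]_x (g x)%:E < +oo)%E ->
    (\int[lebesgue R d]_x (f x)%:E < +oo)%E.
  move=> mg c0 f0 g0 fg goo.
  apply: (@le_lt_trans _ _ (c%:E * \int[lebesgue R d]_x (g x)%:E)%E).
    rewrite -ge0_integralZl_EFin; [|exact: measurableT|
      by move=> x _; rewrite lee_fin|exact/measurable_EFinP|exact: c0].
    apply: ge0_le_integral_sup => x; first by rewrite lee_fin.
    by rewrite -EFinM lee_fin.
  by rewrite lte_mul_pinfty.
split.
  move=> [[mu _] uoo]; split => //.
  apply: (scale (fun x => `|u x| * weight 1 a x) (fun x => `|u x| / w1 x) 2
    _ _ _ _ _ uoo).
  - apply: (measurable_funM (measurable_normu mu)).
    exact: (borel_lebesgue_measurable mw1V).
  - exact: ler0n.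
  - by move=> x; rewrite mulr_ge0// weight_ge0.
  - by move=> x; rewrite divr_ge0// ltW.
  move=> x; rewrite wE mulrCA ler_wpM2l// ler_pdivlMr ?w1_gt0//.
  rewrite mulrC ler_pdivrMr// w1E; exact: japanese_bracket_le.
move=> [mu uoo]; have uoo' : (\int[lebesgue R d]_x (`|u x| / w1 x)%:E < +oo)%E.
  move: uoo; apply: (scale _ _ (2 `^ a)).
  - apply: (measurable_funM (measurable_normu mu)).
    apply: borel_lebesgue_measurable; exact: measurable_weight.
  - exact: powR_ge0.
  - by move=> x; rewrite divr_ge0// ltW.
  - by move=> x; rewrite mulr_ge0// weight_ge0.
  move=> x; rewrite wE mulrCA ler_wpM2l// ler_pdivlMr ?q_gt0//.
  rewrite mulrC ler_pdivrMr// w1E; exact: japanese_bracket_ge.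
split => //; split => // C cptC.
have [M M0 CM] : exists2 M, 0 <= M & forall x, C x -> w1 x <= M.
  have [M CM] := compact_sqnorm_bounded cptC.
  exists (1 + `|M| `^ a); first by rewrite addr_ge0 ?powR_ge0.
  move=> x /CM xM; rewrite w1E lerD2l ge0_ler_powR ?nnegrE ?z0//.
  exact: le_trans xM (ler_norm _).
rewrite integral_mkcond.
apply: (@le_lt_trans _ _ (\int[lebesgue R d]_x (M * (`|u x| / w1 x))%:E)%E).
  apply: ge0_le_integral_sup => x.
    by rewrite patchE; case: ifP => // _; rewrite lee_fin.
  rewrite patchE; case: ifPn => [/set_mem Cx|_]; rewrite lee_fin.
    by rewrite mulrCA ler_peMr// ler_pdivlMr// mul1r CM.
  by rewrite mulr_ge0// divr_ge0// ltW.
apply: (scale (fun x => M * (`|u x| / w1 x)) (fun x => `|u x| / w1 x) M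
  _ _ _ _ _ uoo').
- apply: (measurable_funM (measurable_normu mu)).
  exact: (borel_lebesgue_measurable mw1V).
- exact: M0.
- by move=> x; rewrite mulr_ge0// divr_ge0// ltW.
- by move=> x; rewrite divr_ge0// ltW.
- by move=> x; exact: lexx.
Qed.

Lemma L1s_init d (s : R) (v : 'rV[R]_d -> R) : (0 < d)%N -> 0 < s ->
  L1s s v <-> L1s s (v \o @init R d).
Proof.
move=> d0 s0; set a := d%:R / 2 + s.
have d1 : 1 <= d%:R :> R by rewrite ler1n.
have aE : d.+1%:R / 2 + s = a + 2^-1 by rewrite /a -[d.+1]addn1 natrD; lra.
have a0 : 2^-1 <= a by rewrite /a; lra.
have K0 : (0 < K (a + 2^-1))%E by apply: japanese_integral_gt0; lra.
have Koo : (K (a + 2^-1) < +oo)%E by apply: japanese_integral_fin; lra.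
have integralE : measurable_fun [set: lebesgueRd R d] v ->
   (\int[lebesgue R d.+1]_z (`|v (init z)| * weight 1 (a + 2^-1) z)%:E =
    K (a + 2^-1) * \int[lebesgue R d]_x (`|v x| * weight 1 a x)%:E)%E.
  move=> mv; have mnv : measurable_fun [set: lebesgueRd R d] (fun x => `|v x|).
    by apply: (measurableT_comp (f := @Num.norm R R)).
  apply: (lebesgue_integral_cylinder mnv ler01 a0) => x x0.
  by exfalso; have := sqnorm_ge0 x; lra.
split=> /(L1sE _ s0)[mv voo]; apply/(L1sE _ s0).
  split; first exact: ((lebesgue_measurable_init v).1 mv).
  rewrite aE [X in (X < _)%E](integralE mv).
  by apply: lte_mul_pinfty voo; [exact: ltW|rewrite ge0_fin_numE// ltW].
have {}mv := (lebesgue_measurable_init v).2 mv; split; first exact: mv.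
move: voo; rewrite aE [X in (X < _)%E](integralE mv).
have : (0 <= \int[lebesgue R d]_x (`|v x| * weight 1 a x)%:E)%E.
  by apply: integral_ge0 => x _; rewrite lee_fin mulr_ge0 ?weight_ge0.
rewrite -/a; case: (integral _ _ _) => [r| |]// _; first by rewrite ltry.
by rewrite gt0_muley.
Qed.

End weighted_class.

(** * The fractional Laplacian *)

Section fractional_laplacian.
Context (R : realType).
Local Notation K := (@japanese_integral R).

Lemma cdiff_init d m (v : 'rV[R]_d -> R) (x y : 'rV[R]_d.+1) :
  cdiff m (v \o @init R d) x y = cdiff m v (init x) (init y).
Proof. by rewrite /cdiff; apply: eq_bigr => i _ /=; rewrite initD initZ. Qed.

(** The coefficients are those of (1 - 1)^(2m+2), up to sign. *)
Lemma cdiff0 d m (v : 'rV[R]_d -> R) x : cdiff m v x 0 = 0.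
Proof.
rewrite /cdiff.
under eq_bigr do rewrite scaler0 addr0.
rewrite -mulr_suml big_mkord addn3; apply/eqP; rewrite mulf_eq0; apply/orP; left.
apply/eqP; transitivity ((-1) ^ (m + 1)%:Z * (1 - 1) ^+ (2 * m + 2) : R);
  last by rewrite subrr expr0n addn2 mulr0.
rewrite exprBn mulr_sumr addn2; apply: eq_bigr => i _.
rewrite !expr1n !mulr1 -[in RHS]mulr_natr mulrA; congr (_ * _).
rewrite expfzDr ?oppr_eq0 ?oner_eq0//; congr (_ * _).
by rewrite -exprnN -exprVn invrN1.
Qed.

Lemma measurable_cdiff d m (v : 'rV[R]_d -> R) x :
  measurable_fun [set: lebesgueRd R d] v ->
  measurable_fun [set: lebesgueRd R d] (cdiff m v x).
Proof.
move=> mv; apply: measurable_sum => i /=.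
exact: (measurable_funM (measurable_cst _) (lebesgue_measurable_affine _ _ mv)).
Qed.

Lemma sqnorm_eq0 d (x : 'rV[R]_d) : sqnorm x = 0 -> x = 0.
Proof.
move=> /eqP; rewrite psumr_eq0; last by move=> i _; exact: sqr_ge0.
move=> /allP x0; apply/rowP => i; rewrite mxE.
by have /implyP := x0 i (mem_index_enum i); rewrite sqrf_eq0 => /(_ isT)/eqP.
Qed.

(** The powers of pi differ by the factor sqrt pi, and the Gamma factors are
    related by [Gamma_pos_japanese]; everything else in the constant depends on s
    only. *)
Lemma cds_japanese d (s : R) : (0 < d)%N -> 0 < s ->
  cds d.+1 s * fine (K (d%:R / 2 + s + 2^-1)) = cds d s.
Proof.
move=> d0 s0; set a := d%:R / 2 + s.
have d1 : 1 <= d%:R :> R by rewrite ler1n.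
have aE : d.+1%:R / 2 + s = a + 2^-1 by rewrite /a -[d.+1]addn1 natrD; lra.
have GammaE (x : R) : 0 <= x -> Gamma x = Gamma_pos x.
  by move=> x0; rewrite /Gamma min_l ?floor_ge0// big_ord0 divr1 addr0.
rewrite /cds aE (GammaE a) ?(GammaE (a + 2^-1)); [|rewrite /a; lra..].
have : Gamma_pos (a + 2^-1) * fine (K (a + 2^-1)) = Num.sqrt pi * Gamma_pos a.
  rewrite Gamma_pos_japanese ?addrK//.
  - by apply: japanese_integral_fin; rewrite /a; lra.
  - by apply: japanese_integral_gt0; rewrite /a; lra.
have -> : pi `^ (d.+1%:R / 2) = pi `^ (d%:R / 2) * Num.sqrt pi :> R.
  rewrite -powR12_sqrt ?pi_ge0// -powRD; last by rewrite gt_eqF ?pi_gt0 ?implybT.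
  by congr (_ `^ _); rewrite -[d.+1]addn1 natrD; lra.
have pi_neq0 : Num.sqrt pi != 0 :> R by rewrite sqrtr_eq0 -ltNge pi_gt0.
set S := (\sum_(_ <= _ < _) _)^-1; set k := fine _.
set G1 := Gamma_pos _; set G0 := Gamma_pos _.
set P := pi `^ _; set r := Num.sqrt pi in pi_neq0 *.
move: (Gamma (- s)) => g GE.
rewrite !invfM.
transitivity (4 `^ s * (G1 * k) * (P^-1 * r^-1 * g^-1) * S); first by ring.
rewrite GE.
transitivity (4 `^ s * G0 * (P^-1 * g^-1) * S * (r * r^-1)); first by ring.
by rewrite mulfV// mulr1.
Qed.

(** The factor K produced by integrating out the last variable is the quotient of
    the normalizing constants. *)
Lemma frac_laplacian_init_integral d (s : R) (v : 'rV[R]_d -> R) (x : 'rV[R]_d.+1) :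
  (0 < d)%N -> 0 < s -> fpart s != 1 -> measurable_fun [set: lebesgueRd R d] v ->
  frac_laplacian s (v \o @init R d) x = frac_laplacian s v (init x).
Proof.
move=> d0 s0 sn1 mv; rewrite /frac_laplacian (negbTE sn1).
set m := ipart s; set a := d%:R / 2 + s.
have d1 : 1 <= d%:R :> R by rewrite ler1n.
have wE d' (y : 'rV[R]_d') :
    (enorm y `^ (d'%:R + 2 * s))^-1 = weight 0 (d'%:R / 2 + s) y.
  by rewrite /weight enorm_powR add0r powRN; congr ((_ `^ _)^-1); lra.
rewrite -(cds_japanese d0 s0) -/a /Rintegral.
under eq_integral do rewrite cdiff_init wE.
under [in RHS]eq_integral do rewrite wE -/a.
have -> : d.+1%:R / 2 + s = a + 2^-1 by rewrite /a -[d.+1]addn1 natrD; lra.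
rewrite (lebesgue_integral_cylinder (h := cdiff m v (init x)))//; last 3 first.
- exact: measurable_cdiff.
- by rewrite /a; lra.
- by move=> y; rewrite add0r => /sqnorm_eq0 ->; exact: cdiff0.
have K0 : (0 < K (a + 2^-1))%E by apply: japanese_integral_gt0; rewrite /a; lra.
have Koo : (K (a + 2^-1) < +oo)%E by apply: japanese_integral_fin; rewrite /a; lra.
rewrite -/a; set I := integral _ _ _.
have -> : fine (K (a + 2^-1) * I) = fine (K (a + 2^-1)) * fine I.
  have Kfin : K (a + 2^-1) \is a fin_num by rewrite ge0_fin_numE// ltW.
  have fK : 0 < fine (K (a + 2^-1)) by rewrite fine_gt0// K0 Koo.
  rewrite -{1}(fineK Kfin).
  by case: I => [r| |]/=; rewrite ?gt0_muley ?gt0_muleNy//= mulr0.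
by rewrite mulrA; congr (_ * _); rewrite mulrAC.
Qed.

End fractional_laplacian.

(** * Derivatives of cylindrical functions *)

Section derivatives.
Context (R : realType).

(** The difference quotients are equal, so that this holds whether or not the
    derivatives exist. *)
Lemma derive_init d (g : 'rV[R]_d -> R) x w :
  'D_w (g \o @init R d) x = 'D_(init w) g (init x).
Proof.
rewrite /derive.
set F := (X in lim (X @ _)); set G := (X in _ = lim (X @ _)).
suff -> : F = G by [].
by apply/funext => h; rewrite /F/G/= initD initZ.
Qed.

Lemma derivable_init d (g : 'rV[R]_d -> R) x w :
  derivable (g \o @init R d) x w <-> derivable g (init x) (init w).
Proof.
rewrite /derivable.
set F := (X in cvg (X @ _)); set G := (X in _ <-> cvg (X @ _)).
suff -> : F = G by [].
by apply/funext => h; rewrite /F/G/= initD initZ.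
Qed.

Lemma is_derive_direction0 d (g : 'rV[R]_d -> R) x : is_derive x 0 g 0.
Proof.
have E : (fun h : R => h^-1 *: ((g \o shift x) (h *: 0) - g x)) = cst 0.
  by apply/funext => h /=; rewrite scaler0 add0r subrr scaler0.
apply: DeriveDef; first by rewrite /derivable E; exact: is_cvg_cst.
by rewrite /derive E; exact: lim_cst.
Qed.

Lemma init_basis_lift d (j : 'I_d) :
  init (basis_vec R (lift ord_max j)) = basis_vec R j.
Proof.
apply/rowP => i; rewrite !mxE widen_ord_max /=.
by rewrite (inj_eq (@lift_inj _ _)).
Qed.

Lemma init_basis_max d : init (basis_vec R (@ord_max d)) = 0.
Proof.
apply/rowP => i; rewrite !mxE widen_ord_max /=.
by rewrite eq_sym (negbTE (neq_lift _ _)).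
Qed.

Lemma dpartial_cons d i (l : seq 'I_d) (f : 'rV[R]_d -> R) x :
  dpartial (i :: l) f x = 'D_(basis_vec R i) (dpartial l f) x.
Proof. by []. Qed.

Lemma dpartial_init d (v : 'rV[R]_d -> R) (l : seq 'I_d) :
  dpartial (map (lift ord_max) l) (v \o @init R d) = dpartial l v \o @init R d.
Proof.
elim: l => // i l IH; apply/funext => x.
by rewrite map_cons dpartial_cons IH derive_init init_basis_lift.
Qed.

(** A derivative in the last direction is 0 everywhere, and so are the further
    derivatives. *)
Lemma dpartial_init_cases d (v : 'rV[R]_d -> R) (l : seq 'I_d.+1) :
  (exists l', l = map (lift ord_max) l') \/ dpartial l (v \o @init R d) = cst 0.
Proof.
elim: l => [|i l [[l' ->]|IH]]; first by left; exists [::].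
  case: (unliftP ord_max i) => [j ->|->]; first by left; exists (j :: l').
  right; apply/funext => x; rewrite dpartial_cons dpartial_init derive_init init_basis_max.
  by rewrite (@derive_val _ _ _ _ _ _ _ (is_derive_direction0 _ _)).
right; apply/funext => x; rewrite dpartial_cons IH.
exact: derive_cst.
Qed.

Lemma init_continuous d : continuous (@init R d).
Proof.
move=> x A /nbhs_ballP[e e0 eA]; apply/nbhs_ballP; exists e => //= y [_ xy].
by apply: eA; split => // i j; rewrite !mxE; exact: xy.
Qed.

Definition embed d (y : 'rV[R]_d) : 'rV[R]_d.+1 := row_rcons (y, 0).

Lemma embedK d : cancel (@embed d) (@init R d).
Proof. by move=> y; exact: init_row_rcons. Qed.

Lemma embed_continuous d : continuous (@embed d).
Proof.
move=> x A /nbhs_ballP[e e0 eA]; apply/nbhs_ballP; exists e => //= y [_ xy].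
apply: eA; split => // i j; rewrite !mxE /=; case: unliftP => [k _|_]; first exact: xy.
exact: ballxx.
Qed.

Lemma enorm_init d (z : 'rV[R]_d.+1) : enorm (init z) <= enorm z.
Proof.
rewrite ler_wsqrtr// -[leRHS]/(sqnorm z) -[in leRHS](row_rcons_init z).
by rewrite sqnorm_row_rcons lerDl sqr_ge0.
Qed.

Lemma enorm_embedB d (y z : 'rV[R]_d) : enorm (embed y - embed z) = enorm (y - z).
Proof.
have -> : embed y - embed z = embed (y - z).
  by rewrite -scaleN1r row_rconsD scaleN1r mulr0 addr0.
by rewrite /enorm -/(sqnorm _) sqnorm_row_rcons expr0n addr0.
Qed.

(** The derivatives that involve the last direction vanish; the others are those of
    v, pulled back. *)
Lemma Cn_init d n (V : set 'rV[R]_d) (v : 'rV[R]_d -> R) :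
  Cn n V v <-> Cn n (@init R d @^-1` V) (v \o @init R d).
Proof.
split=> -[der cont]; split.
- move=> l i x ln Vx; case: (dpartial_init_cases v l) => [[l' lE]|->]; last first.
    exact: derivable_cst.
  rewrite lE dpartial_init; apply/derivable_init.
  case: (unliftP ord_max i) => [j ->|->].
    rewrite init_basis_lift; apply: der => //.
    by rewrite -(size_map (lift ord_max)) -lE.
  by rewrite init_basis_max; case: (is_derive_direction0 (dpartial l' v) (init x)).
- move=> l x ln Vx; case: (dpartial_init_cases v l) => [[l' lE]|->]; last first.
    exact: cst_continuous.
  rewrite lE dpartial_init; apply: continuous_comp; first exact: init_continuous.
  by apply: cont => //; rewrite -(size_map (lift ord_max)) -lE.
- move=> l i x ln Vx.
  have := der (map (lift ord_max) l) (lift ord_max i) (embed x).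
  rewrite size_map dpartial_init /= embedK => /(_ ln Vx)/derivable_init.
  by rewrite embedK init_basis_lift.
- move=> l x ln Vx.
  have := cont (map (lift ord_max) l) (embed x).
  rewrite size_map dpartial_init /= embedK => /(_ ln Vx) h.
  rewrite (_ : dpartial l v = (dpartial l v \o @init R d) \o @embed d); last first.
    by apply/funext => y /=; rewrite embedK.
  by apply: continuous_comp => //; exact: embed_continuous.
Qed.

Lemma locally_hoelder_init d tau (V : set 'rV[R]_d) (g : 'rV[R]_d -> R) :
  0 < tau ->
  locally_hoelder tau V g <->
  locally_hoelder tau (@init R d @^-1` V) (g \o @init R d).
Proof.
move=> tau0; split=> hg x Vx.
  have [A nA [C AC]] := hg _ Vx.
  exists (@init R d @^-1` A); first exact: init_continuous.
  exists `|C| => y z [Vy Ay] [Vz Az].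
  apply: le_trans (AC _ _ (conj Vy Ay) (conj Vz Az)) _.
  apply: (@le_trans _ _ (`|C| * enorm (init y - init z) `^ tau)).
    by rewrite ler_wpM2r ?powR_ge0 ?ler_norm.
  have -> : init y - init z = init (y - z) by rewrite -scaleN1r initD -initZ scaleN1r.
  rewrite ler_wpM2l// ge0_ler_powR ?(ltW tau0) ?nnegrE ?sqrtr_ge0//.
  exact: enorm_init.
have Ux : (@init R d @^-1` V) (embed x) by rewrite /= embedK.
have [A nA [C AC]] := hg _ Ux.
exists (@embed d @^-1` A); first exact: embed_continuous.
exists C => y z [Vy Ay] [Vz Az].
have := AC (embed y) (embed z); rewrite /= !embedK enorm_embedB; exact.
Qed.

Lemma Ct_init d t (V : set 'rV[R]_d) (v : 'rV[R]_d -> R) : 0 < t ->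
  Ct t V v <-> Ct t (@init R d @^-1` V) (v \o @init R d).
Proof.
move=> /fpart_bounds/andP[tau0 _]; rewrite /Ct -Cn_init.
split=> -[CnV hold]; split=> // l ln.
  case: (dpartial_init_cases v l) => [[l' lE]|->].
    rewrite lE dpartial_init -locally_hoelder_init//; apply: hold.
    by rewrite -ln lE size_map.
  move=> x _; exists setT; first exact: filterT.
  by exists 0 => y z _ _; rewrite /cst subrr normr0 mul0r.
apply/locally_hoelder_init => //; rewrite -dpartial_init; apply: hold.
by rewrite size_map.
Qed.

Lemma laplacian_init d (g : 'rV[R]_d -> R) :
  laplacian (g \o @init R d) = laplacian g \o @init R d.
Proof.
apply/funext => x; rewrite /laplacian big_ord_recr /= [X in _ + X](_ : _ = 0).
  rewrite addr0; apply: eq_bigr => i _.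
  have -> : widen_ord (leqnSn d) i = lift ord_max i.
    by rewrite -widen_ord_max; exact: val_inj.
  by have /(congr1 (@^~ x)) := dpartial_init g [:: i; i].
case: (dpartial_init_cases g [:: ord_max; ord_max]) => [[l lE]|].
  have : ord_max \in map (lift ord_max) l by rewrite -lE inE eqxx.
  by move=> /mapP[j _ /eqP]; rewrite (negbTE (neq_lift _ _)).
by move=> /(congr1 (@^~ x)).
Qed.

Lemma frac_laplacian_init d (s : R) (v : 'rV[R]_d -> R) (x : 'rV[R]_d.+1) :
  (0 < d)%N -> 0 < s -> measurable_fun [set: lebesgueRd R d] v ->
  frac_laplacian s (v \o @init R d) x = frac_laplacian s v (init x).
Proof.
move=> d0 s0 mv; have [s1|s1] := eqVneq (fpart s) 1; last first.
  exact: frac_laplacian_init_integral.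
rewrite /frac_laplacian s1 eqxx.
move: (ipart s).+1 => n.
suff -> : iter n (fun (f : 'rV[R]_d.+1 -> R) y => - laplacian f y) (v \o @init R d) =
    iter n (fun f y => - laplacian f y) v \o @init R d by [].
elim: n => // n IH; apply/funext => y.
by rewrite iterS IH laplacian_init.
Qed.

End derivatives.

(** * Adding several coordinates *)

Lemma first_coords_step (R : realType) k N (kN : (k < N)%N) (kSN : (k < N.+1)%N)
    (z : 'rV[R]_N.+1) : first_coords kSN z = first_coords kN (init z).
Proof. by apply/rowP => i; rewrite !mxE; congr (z 0 _); exact: val_inj. Qed.

Lemma first_coords_init (R : realType) k (kN : (k < k.+1)%N) :
  first_coords kN = @init R k.
Proof. by rewrite /init (bool_irrelevance kN (ltnSn k)). Qed.

Lemma first_coords_surj (R : realType) k N (kN : (k < N)%N) (y : 'rV[R]_k) :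
  exists x, first_coords kN x = y.
Proof.
exists (\row_i (if insub (val i) is Some j then y 0 j else 0)).
apply/rowP => i; rewrite !mxE /=; case: insubP => [j _ jE|]; last by rewrite ltn_ord.
by congr (y 0 _); exact: val_inj.
Qed.

(** Induction on N, where R^N.+1 -> R^k is factored through R^N. *)
Lemma first_coords_lift (R : realType) (s t : R) k N (kN : (k < N)%N)
    (V : set 'rV[R]_k) (v : 'rV[R]_k -> R) : 0 < s -> 0 < t -> (0 < k)%N ->
  [/\ L1s s v <-> L1s s (v \o first_coords kN),
    Ct t V v <-> Ct t (first_coords kN @^-1` V) (v \o first_coords kN) &
    L1s s v -> forall x, frac_laplacian s (v \o first_coords kN) x =
      frac_laplacian s v (first_coords kN x)].
Proof.
move=> s0 t0 k0; elim: N kN => [kN|N IH kSN]; first by have := kN; rewrite ltn0.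
have := kSN; rewrite ltnS leq_eqVlt => /predU1P[kE|kN].
  move: kSN; rewrite -{}kE => kSN {N IH}; rewrite first_coords_init; split.
  - exact: L1s_init.
  - exact: Ct_init.
  - by move=> [[mv _] _] x; exact: frac_laplacian_init.
have [IHL1s IHCt IHfrac] := IH kN.
have N0 := ltn_trans k0 kN.
have vE : v \o first_coords kSN = (v \o first_coords kN) \o @init R N.
  by apply/funext => z /=; rewrite (first_coords_step kN).
have VE : first_coords kSN @^-1` V = @init R N @^-1` (first_coords kN @^-1` V).
  by apply/seteqP; split => z /=; rewrite (first_coords_step kN).
rewrite vE VE; split.
- exact: (iff_trans IHL1s (L1s_init _ N0 s0)).
- exact: (iff_trans IHCt (Ct_init _ _ t0)).
move=> Lv x; have [[mv _] _] := IHL1s.1 Lv.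
by rewrite frac_laplacian_init// IHfrac// (first_coords_step kN).
Qed.

Unset Implicit Arguments.

Theorem lemma1p5 (R : realType) (s beta : R) (k N : nat)
    (V : set 'rV[R]_k) (u : 'rV[R]_N -> R) (v : 'rV[R]_k -> R)
    (s_gt0 : 0 < s) (beta_01 : 0 < beta < 1)
    (k_gt0 : (0 < k)%N) (kN : (k < N)%N) (openV : open V)
    (uv : forall x : 'rV[R]_N, u x = v (first_coords kN x)) :
  let U : set 'rV[R]_N := [set x | V (first_coords kN x)] in
  let regular_v := L1s s v /\ Ct (2 * s + beta) V v in
  let regular_u := L1s s u /\ Ct (2 * s + beta) U u in
  [/\ regular_v <-> regular_u,
      regular_v -> forall x : 'rV[R]_N, U x ->
        frac_laplacian s u x = frac_laplacian s v (first_coords kN x)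
    & regular_v -> (s_harmonic s U u <-> s_harmonic s V v)].
Proof.
move=> U regular_v regular_u.
have t_gt0 : 0 < 2 * s + beta.
  by have /andP[beta_gt0 _] := beta_01; rewrite addr_gt0// mulr_gt0.
have uE : u = v \o first_coords kN by apply/funext => x; rewrite uv.
have [L1sP CtP frac] := first_coords_lift kN V v s_gt0 t_gt0 k_gt0.
rewrite /regular_v /regular_u /s_harmonic uE; split.
- by rewrite [X in X /\ _]L1sP [X in _ /\ X]CtP.
- by move=> [Lv _] x _; exact: frac.
move=> [/frac fracE _]; split=> harm x Wx; last by rewrite fracE; exact: harm.
have [z zx] := first_coords_surj kN x.
by rewrite -zx -fracE; apply: harm; rewrite /U /= zx.
Qed.
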